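(* Let $\Omega\subset\mathbb{H}$ be a slice contractible circular domain and $g\in\mathcal{R}(\Omega)$. If $g^s\equiv1$ and for any $q_0\in\Omega$ that is a non-real isolated zero of $g_v$ we have $g_0(q_0)=1$, then on every connected component $\mathcal{U}$ of $\Omega\setminus g_0^{-1}((-\infty,-1])$ there exists a $*$-logarithm of $g$, i.e. a function $f\in\mathcal{R}(\mathcal{U})$ with $\exp_*(f)=g|_{\mathcal{U}}$.
   Context: $\mathbb{H}$ is the algebra of quaternions; $q=q_0+q_v$ with $q_0$ real and $q_v$ purely imaginary, $q^c=q_0-q_v$, $\mathbb{S}=\{I\in\mathbb{H}: I^2=-1\}$, $\mathbb{C}_I=\mathbb{R}+\mathbb{R}I$, $\mathbb{C}_I^+=\{\alpha+I\beta:\beta\ge0\}$, $\mathbb{S}_q=\{q_0+\|q_v\|J: J\in\mathbb{S}\}$, $\Omega_I=\Omega\cap\mathbb{C}_I$, $\Omega_I^+=\Omega\cap\mathbb{C}_I^+$. A domain (nonempty connected open set) $\Omega\subset\mathbb{H}$ is circular if $\mathbb{S}_q\subset\Omega$ for all $q\in\Omega$; it is a slice domain if $\Omega\cap\mathbb{R}\neq\emptyset$ and a product domain if $\Omega\cap\mathbb{R}=\emptyset$. It is slice contractible if, for some (equivalently any) $I\in\mathbb{S}$, $\Omega_I$ is a simply connected domain when $\Omega$ is slice, respectively $\Omega_I^+$ is a simply connected domain when $\Omega$ is product. A function $f:\Omega\to\mathbb{H}$ is slice regular if $f(\alpha+I\beta)=F_0(\alpha+\sqrt{-1}\beta)+I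 F_1(\alpha+\sqrt{-1}\beta)$ for all $I\in\mathbb{S}$ and $\alpha,\beta\in\mathbb{R}$ with $\alpha+I\beta\in\Omega$, where $F_0,F_1:\{\alpha+\sqrt{-1}\beta:\alpha+I\beta\in\Omega\}\to\mathbb{H}$ are $C^1$, $F_0(\bar z)=F_0(z)$, $F_1(\bar z)=-F_1(z)$ and $\partial_\alpha F_0=\partial_\beta F_1$, $\partial_\beta F_0=-\partial_\alpha F_1$. $\mathcal{R}(\Omega)$ is the set of slice regular functions; $f\in\mathcal{R}(\Omega)$ is slice preserving if $f(\Omega_I)\subset\mathbb{C}_I$ for all $I\in\mathbb{S}$, and $\mathcal{R}_{\mathbb{R}}(\Omega)$ is the set of slice preserving functions. The $*$-product is $(f*g)(q)=0$ if $f(q)=0$, and $(f*g)(q)=f(q)\,g(f(q)^{-1}qf(q))$ otherwise; with pointwise sum it makes $\mathcal{R}(\Omega)$ an associative algebra. The slice conjugate $f^c$ is the function induced by $(F_0^c,F_1^c)$ (pointwise conjugates), and $f^s=f*f^c$. Every $f\in\mathcal{R}(\Omega)$ is uniquely $f=f_0+f_1i+f_2j+f_3k$ with $f_\ell\in\mathcal{R}_{\mathbb{R}}(\Omega)$; $f_0$ is its real part and $f_v=f-f_0$ its vector part. $\exp_*(f)=\sum_{n\ge0}f^{*n}/n!$, with $f^{*n}$ the $n$-th $*$-power. Since $g_0$ is slice preserving, $g_0^{-1}((-\infty,-1])$ is circular and each connected component of its complement in $\Omega$ is a circular domain. Non-real isolated zeroes: let $f\in\mathcal{R}(\Omega)$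 with $f^s\not\equiv0$ and $q_0\in\Omega\setminus\mathbb{R}$. Write $f=\Delta^m\tilde f$ with $m\ge0$ the largest integer for which this is possible with $\tilde f\in\mathcal{R}(\Omega)$, where $\Delta(q)=q^2-2q\,\mathrm{Re}(q_0)+|q_0|^2$ (so $\tilde f\not\equiv0$ on $\mathbb{S}_{q_0}$). The point $q_0$ is a non-real isolated zero of $f$ if $\tilde f(q_0)=0$. If $f^s\equiv0$, $f$ has no non-real isolated zeroes. *)

(* Defs.v *)
From HB Require Import structures.
From mathcomp Require Import all_boot all_order all_algebra.
From mathcomp Require Import all_classical all_reals all_analysis.
From mathcomp Require Import ring.

Set Implicit Arguments.
Unset Strict Implicit.
Unset Printing Implicit Defensive.

Import Order.TTheory GRing.Theory Num.Theory.
Import numFieldNormedType.Exports.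

Local Open Scope classical_set_scope.
Local Open Scope ring_scope.

(* Quat a b c d stands for a + b i + c j + d k. *)
Record quat (R : realType) :=
  Quat { coord0 : R; coord1 : R; coord2 : R; coord3 : R }.

Section quaternions.
Variable R : realType.
Implicit Types (a : R) (p q : quat R).

Definition quat_coords q : R * R * R * R :=
  (coord0 q, coord1 q, coord2 q, coord3 q).
Definition quat_of_coords (x : R * R * R * R) : quat R :=
  Quat x.1.1.1 x.1.1.2 x.1.2 x.2.

Lemma quat_coordsK : cancel quat_coords quat_of_coords.
Proof. by case. Qed.

HB.instance Definition _ := Choice.copy (quat R) (can_type quat_coordsK).

Definition addq p q := Quat (coord0 p + coord0 q) (coord1 p + coord1 q)
  (coord2 p + coord2 q) (coord3 p + coord3 q).
Definition oppq q :=
  Quat (- coord0 q) (- coord1 q) (- coord2 q) (- coord3 q).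
Definition scaleq a q :=
  Quat (a * coord0 q) (a * coord1 q) (a * coord2 q) (a * coord3 q).
Definition mulq p q :=
  let: Quat a b c d := p in let: Quat a' b' c' d' := q in
  Quat (a * a' - b * b' - c * c' - d * d')
       (a * b' + b * a' + c * d' - d * c')
       (a * c' - b * d' + c * a' + d * b')
       (a * d' + b * c' - c * b' + d * a').
Definition qconj q :=
  Quat (coord0 q) (- coord1 q) (- coord2 q) (- coord3 q).
Definition qnormsq q :=
  coord0 q ^+ 2 + coord1 q ^+ 2 + coord2 q ^+ 2 + coord3 q ^+ 2.
Definition invq q := scaleq (qnormsq q)^-1 (qconj q).

Lemma quat_eq (a b c d a' b' c' d' : R) :
  a = a' -> b = b' -> c = c' -> d = d' -> Quat a b c d = Quat a' b' c' d'.
Proof. by move=> -> -> -> ->. Qed.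

Lemma addqA : associative addq.
Proof. by move=> [? ? ? ?] [? ? ? ?] [? ? ? ?]; apply: quat_eq => /=; ring. Qed.

Lemma addqC : commutative addq.
Proof. by move=> [? ? ? ?] [? ? ? ?]; apply: quat_eq => /=; ring. Qed.

Lemma add0q : left_id (Quat 0 0 0 0) addq.
Proof. by move=> [? ? ? ?]; apply: quat_eq => /=; ring. Qed.

Lemma addNq : left_inverse (Quat 0 0 0 0) oppq addq.
Proof. by move=> [? ? ? ?]; apply: quat_eq => /=; ring. Qed.

HB.instance Definition _ :=
  GRing.isZmodule.Build (quat R) addqA addqC add0q addNq.

Lemma mulqA : associative mulq.
Proof. by move=> [? ? ? ?] [? ? ? ?] [? ? ? ?]; apply: quat_eq => /=; ring. Qed.

Lemma mul1q : left_id (Quat 1 0 0 0) mulq.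
Proof. by move=> [? ? ? ?]; apply: quat_eq => /=; ring. Qed.

Lemma mulq1 : right_id (Quat 1 0 0 0) mulq.
Proof. by move=> [? ? ? ?]; apply: quat_eq => /=; ring. Qed.

Lemma mulqDl : left_distributive mulq +%R.
Proof. by move=> [? ? ? ?] [? ? ? ?] [? ? ? ?]; apply: quat_eq => /=; ring. Qed.

Lemma mulqDr : right_distributive mulq +%R.
Proof. by move=> [? ? ? ?] [? ? ? ?] [? ? ? ?]; apply: quat_eq => /=; ring. Qed.

Lemma oneq_neq0 : Quat 1 0 0 0 != 0.
Proof. by apply/eqP => -[] /eqP; rewrite oner_eq0. Qed.

HB.instance Definition _ := GRing.Zmodule_isNzRing.Build (quat R)
  mulqA mul1q mulq1 mulqDl mulqDr oneq_neq0.

Lemma scaleqA (a b : R) q : scaleq a (scaleq b q) = scaleq (a * b) q.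
Proof. by apply: quat_eq => /=; ring. Qed.

Lemma scale1q : left_id 1 scaleq.
Proof. by move=> [? ? ? ?]; apply: quat_eq => /=; ring. Qed.

Lemma scaleqDr : right_distributive scaleq +%R.
Proof. by move=> ? [? ? ? ?] [? ? ? ?]; apply: quat_eq => /=; ring. Qed.

Lemma scaleqDl q : {morph scaleq^~ q : a b / a + b}.
Proof. by move=> a b; apply: quat_eq => /=; ring. Qed.

HB.instance Definition _ := GRing.Zmodule_isLmodule.Build R (quat R)
  scaleqA scale1q scaleqDr scaleqDl.

Lemma scaleqAl a p q : a *: (p * q) = (a *: p) * q.
Proof. by move: p q => [? ? ? ?] [? ? ? ?]; apply: quat_eq => /=; ring. Qed.

HB.instance Definition _ :=
  GRing.Lmodule_isLalgebra.Build R (quat R) scaleqAl.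

Lemma scaleqAr a p q : a *: (p * q) = p * (a *: q).
Proof. by move: p q => [? ? ? ?] [? ? ? ?]; apply: quat_eq => /=; ring. Qed.

HB.instance Definition _ := GRing.Lalgebra_isAlgebra.Build R (quat R) scaleqAr.

Lemma quat_algE a : a%:A = Quat a 0 0 0.
Proof. by apply: quat_eq => /=; ring. Qed.

Lemma qnormsq_ge0 q : 0 <= qnormsq q.
Proof. by rewrite /qnormsq !addr_ge0// sqr_ge0. Qed.

Lemma qnormsq_eq0 q : (qnormsq q == 0) = (q == 0).
Proof.
case: q => a b c d; rewrite /qnormsq /= !paddr_eq0 ?addr_ge0 ?sqr_ge0//.
rewrite !sqrf_eq0; apply/idP/eqP => [/andP[/andP[/andP[]]]|[-> -> -> ->]].
  by do 4 move=> /eqP ->.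
by rewrite eqxx.
Qed.

Definition qnorm q := Num.sqrt (qnormsq q).

Lemma qnormD p q : qnorm (p + q) <= qnorm p + qnorm q.
Proof.
pose d := coord0 p * coord0 q + coord1 p * coord1 q +
  coord2 p * coord2 q + coord3 p * coord3 q.
have dE : d ^+ 2 <= qnormsq p * qnormsq q.
  rewrite -subr_ge0.
  suff -> : qnormsq p * qnormsq q - d ^+ 2 =
      (coord0 p * coord1 q - coord1 p * coord0 q) ^+ 2 +
      (coord0 p * coord2 q - coord2 p * coord0 q) ^+ 2 +
      (coord0 p * coord3 q - coord3 p * coord0 q) ^+ 2 +
      (coord1 p * coord2 q - coord2 p * coord1 q) ^+ 2 +
      (coord1 p * coord3 q - coord3 p * coord1 q) ^+ 2 +
      (coord2 p * coord3 q - coord3 p * coord2 q) ^+ 2.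
    by rewrite !addr_ge0// sqr_ge0.
  by rewrite /d /qnormsq; ring.
have pq : d <= qnorm p * qnorm q.
  rewrite /qnorm -sqrtrM ?qnormsq_ge0// (le_trans (ler_norm d))//.
  by rewrite -sqrtr_sqr ler_wsqrtr.
have pq0 : 0 <= qnorm p + qnorm q by rewrite addr_ge0// sqrtr_ge0.
rewrite -(ler_pXn2r (ltn0Sn 1)) ?nnegrE ?sqrtr_ge0//.
rewrite sqrrD !sqr_sqrtr ?qnormsq_ge0//.
have -> : qnormsq (p + q) = qnormsq p + d *+ 2 + qnormsq q.
  by rewrite /qnormsq /d mulr2n /=; ring.
by rewrite lerD2r lerD2l lerMn2r.
Qed.

Lemma qnormZ a q : qnorm (a *: q) = `|a| * qnorm q.
Proof.
have -> : `|a| * qnorm q = Num.sqrt (a ^+ 2 * qnormsq q).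
  by rewrite sqrtrM ?sqr_ge0// sqrtr_sqr.
by congr Num.sqrt; rewrite /qnormsq /=; ring.
Qed.

Lemma qnorm0_eq0 q : qnorm q = 0 -> q = 0.
Proof.
move=> /eqP; rewrite sqrtr_eq0 => q0; apply/eqP.
by rewrite -qnormsq_eq0 eq_le q0 qnormsq_ge0.
Qed.

HB.instance Definition _ :=
  Lmodule_isNormed.Build R (quat R) qnormD qnormZ qnorm0_eq0.

Lemma mulq_conj q : q * qconj q = (qnormsq q)%:A.
Proof.
rewrite quat_algE; case: q => ? ? ? ?; apply: quat_eq;
  rewrite /qnormsq /=; ring.
Qed.

Lemma mul_conjq q : qconj q * q = (qnormsq q)%:A.
Proof.
rewrite quat_algE; case: q => ? ? ? ?; apply: quat_eq;
  rewrite /qnormsq /=; ring.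
Qed.

Lemma invqE q : invq q = (qnormsq q)^-1 *: qconj q.
Proof. by []. Qed.

Lemma mulVq : {in [pred q | q != 0], left_inverse 1 invq *%R}.
Proof.
move=> q; rewrite inE -qnormsq_eq0 => q0.
by rewrite invqE -scalerAl mul_conjq scalerA mulVf// scale1r.
Qed.

Lemma mulqV : {in [pred q | q != 0], right_inverse 1 invq *%R}.
Proof.
move=> q; rewrite inE -qnormsq_eq0 => q0.
by rewrite invqE -scalerAr mulq_conj scalerA mulVf// scale1r.
Qed.

Lemma quat_unitP p q : q * p = 1 /\ p * q = 1 -> p \in [pred q | q != 0].
Proof.
move=> [_ pq]; rewrite inE; apply/eqP => p0.
by move: pq; rewrite p0 mul0r => /eqP; rewrite eq_sym oner_eq0.
Qed.

Lemma invq_out : {in [predC [pred q | q != 0]], invq =1 id}.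
Proof.
by move=> q; rewrite !inE negbK => /eqP ->; apply: quat_eq => /=; ring.
Qed.

HB.instance Definition _ := GRing.NzRing_hasMulInverse.Build (quat R)
  mulVq mulqV quat_unitP invq_out.

Definition quat_i : quat R := Quat 0 1 0 0.
Definition quat_j : quat R := Quat 0 0 1 0.
Definition quat_k : quat R := Quat 0 0 0 1.

Definition qvec q : quat R := q - (coord0 q)%:A.

Definition real_quat : set (quat R) := range (fun a : R => a%:A).
Definition imag_units : set (quat R) := [set I | I ^+ 2 = -1].

(* alpha + I beta *)
Definition quat_of (z : R * R) (I : quat R) : quat R := z.1%:A + z.2 *: I.

Definition cplane I : set (quat R) := range (quat_of ^~ I).
Definition chalfplane I : set (quat R) :=
  (quat_of ^~ I) @` [set z | 0 <= z.2].

Definition sphere q : set (quat R) :=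
  [set quat_of (coord0 q, `|qvec q|) J | J in imag_units].

End quaternions.

Section slice_functions.
Variable R : realType.
Local Notation H := (quat R).
Implicit Types (O U A : set H) (f g h : H -> H) (F : R * R -> H).

Definition domain O := [/\ O !=set0, connected O & open O].

Definition circular O := forall q, O q -> sphere q `<=` O.

Definition slice_domain O := domain O /\ O `&` @real_quat R !=set0.
Definition product_domain O := domain O /\ O `&` @real_quat R = set0.

Definition null_homotopic_in A (c : R -> H) :=
  exists h : R * R -> H,
    [/\ {within `[0, 1] `*` `[0, 1], continuous h},
        (forall s t, s \in `[0, 1] -> t \in `[0, 1] -> A (h (s, t))),
        (forall t, t \in `[0, 1] -> h (0, t) = c t),
        (forall t, t \in `[0, 1] -> h (1, t) = c 0) &
        (forall s, s \in `[0, 1] -> h (s, 0) = c 0 /\ h (s, 1) = c 0)].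

(* A is a domain of the plane C, i.e. open in the topology induced on C. *)
Definition simply_connected_domain_of (C A : set H) :=
  [/\ A !=set0, connected A, exists2 V, open V & A = V `&` C &
      forall c : R -> H, {within `[0, 1], continuous c} ->
        (forall t, t \in `[0, 1] -> A (c t)) -> c 0 = c 1 ->
        null_homotopic_in A c].

Definition slice_contractible O :=
  (slice_domain O -> exists2 I, imag_units I &
     simply_connected_domain_of (cplane I) (O `&` cplane I)) /\
  (product_domain O -> exists2 I, imag_units I &
     simply_connected_domain_of (cplane I) (O `&` chalfplane I)).

(* The complex plane in which stem functions are defined is R * R. *)
Definition stem_dom O : set (R * R) :=
  [set z | exists2 I, imag_units I & O (quat_of z I)].

Definition conjz (z : R * R) : R * R := (z.1, - z.2).

Definition d_alpha F : R * R -> H := 'D_((1, 0) : R * R) F.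
Definition d_beta F : R * R -> H := 'D_((0, 1) : R * R) F.

Definition C1_on (D : set (R * R)) F :=
  forall z, D z ->
    [/\ derivable F z (1, 0), derivable F z (0, 1),
        {for z, continuous (d_alpha F)} & {for z, continuous (d_beta F)}].

Definition holomorphic_stem (D : set (R * R)) F0 F1 :=
  [/\ C1_on D F0, C1_on D F1,
      (forall z, D z -> F0 (conjz z) = F0 z /\ F1 (conjz z) = - F1 z) &
      (forall z, D z -> d_alpha F0 z = d_beta F1 z /\
                        d_beta F0 z = - d_alpha F1 z)].

Definition induces O F0 F1 f :=
  forall I z, imag_units I -> O (quat_of z I) ->
    f (quat_of z I) = F0 z + I * F1 z.

Definition stem_of O F0 F1 f :=
  holomorphic_stem (stem_dom O) F0 F1 /\ induces O F0 F1 f.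

(* Functions on O are represented by total functions, of which only the values
   on O are relevant. *)
Definition slice_regular O f := exists F0 F1, stem_of O F0 F1 f.

Definition slice_preserving O f :=
  slice_regular O f /\
  forall I, imag_units I -> f @` (O `&` cplane I) `<=` cplane I.

Definition star f g : H -> H := fun q =>
  if f q == 0 then 0 else f q * g ((f q)^-1 * q * f q).

Definition star_pow f n : H -> H := iter n (star f) (fun=> 1).

Definition slice_conj O f : H -> H :=
  xget (fun=> 0) [set h | exists F0 F1,
    stem_of O F0 F1 f /\ induces O (@qconj R \o F0) (@qconj R \o F1) h].

Definition symmetrization O f : H -> H := star f (slice_conj O f).

Definition real_part O f : H -> H :=
  xget (fun=> 0) [set f0 | exists f1 f2 f3,
    [/\ slice_preserving O f0, slice_preserving O f1,
        slice_preserving O f2, slice_preserving O f3 &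
        forall q, O q ->
          f q = f0 q + f1 q * quat_i R + f2 q * quat_j R + f3 q * quat_k R]].

Definition vector_part O f : H -> H := fun q => f q - real_part O f q.

(* exp_*(f) = h on U *)
Definition is_star_exponential U f h := forall q, U q ->
  [series (n`!%:R : R)^-1 *: star_pow f n q]_n @ \oo --> h q.

Definition sphere_poly (q0 q : H) : H :=
  q ^+ 2 - (2 * q) * (coord0 q0)%:A + (`|q0| ^+ 2)%:A.

(* sphere_poly q0 is slice preserving, so that its *-powers and its *-products
   with other functions are pointwise. *)
Definition sphere_factor O f q0 m ft :=
  slice_regular O ft /\ forall q, O q -> f q = sphere_poly q0 q ^+ m * ft q.

Definition nonreal_isolated_zero O f q0 :=
  [/\ (O `\` @real_quat R) q0,
      ~ (forall q, O q -> symmetrization O f q = 0) &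
      exists m ft, [/\ sphere_factor O f q0 m ft,
        (forall n h, sphere_factor O f q0 n h -> (n <= m)%N) & ft q0 = 0]].

Definition real_le_m1 : set H := [set a%:A | a in [set a : R | a <= -1]].

End slice_functions.

(* Main.v *)
Require Import Defs.
From mathcomp Require Import all_boot all_order all_algebra.
From mathcomp Require Import all_classical all_reals all_analysis.
From mathcomp Require Import complex ring lra.

(** The logarithm is explicit: it is the vector part of [g], multiplied by a
    slice preserving function of [g_0].

    Stem functions take values in the complexified quaternions, where a vector
    element [v] satisfies [v^2 = - w] with [w] a complex number, so that
    [exp v = cos (sqrt w) + (sin (sqrt w) / sqrt w) v].  Write the stem function
    of [g] as [u + V], with [u] complex and [V] a vector.  The equation
    [g^s = 1] says that [V^2 = - (1 - u^2)], hence for [s = arccos u] one has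
    [u = cos s], [V^2 = - (sin s)^2] and [exp ((s / sin s) V) = u + V].  The
    function [k(u) = arccos u / sqrt (1 - u^2)] is holomorphic on the plane slit
    along the half-line of the reals at most -1; in particular it is regular at
    [u = 1], where it equals 1 and [V^2] vanishes.  Therefore [k(u) V] is the
    stem function of a logarithm on the whole complement of
    [g_0^{-1} ((-oo, -1])], and on each component by restriction.

    The value of [k] used here is the integral of the inverse of
    [1 - c(t) (1 - u)], with [c(t) = (1 - t^2) / 2], over [0, 1]: no branch of a
    square root or of a logarithm has to be chosen.  The increment of this
    integral is exactly [(u - v)] times an integral that is continuous on the
    diagonal [u = v], which gives holomorphy, also after composition with stem
    functions ([arccos_ratioB], [slope_cvg], [holomorphic_arccos_ratio]).

    The exponential series is summed along the primitive [y(t)] of the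
    integrand multiplied by [i s], where [s^2 = 1 - u^2].  The rational function
    [G(t) = (1 + u + i s t) / (1 + u - i s t)] satisfies [G' = y' G], so that
    the N-th partial sum of the series at [- y], multiplied by [G], has a
    derivative with the factor [(- y)^N / N!] and is constant in the limit
    ([exp_sum_cvg], [exp_sum_arccos_ratio]).  Taking both square roots [s] and
    [- s] separates the even and odd parts of the series ([exp_coefs_cvg]).

    On quaternions, the points of a sphere are treated together:
    [star_induced] reads the slice product as the product of complexified
    quaternions, and [real_part_stem] and [symmetrization_stem] translate the
    real part and the symmetrization of [g] into its stem function. *)

Set Implicit Arguments.
Unset Strict Implicit.
Unset Printing Implicit Defensive.

Import Order.TTheory GRing.Theory Num.Theory.
Import numFieldNormedType.Exports.
Import ComplexField.Normc.

Local Open Scope classical_set_scope.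
Local Open Scope ring_scope.
Local Open Scope complex_scope.

Local Notation Re := (@complex.Re _).
Local Notation Im := (@complex.Im _).
Local Notation coord0 := (@Defs.coord0 _).

(** * Limits of complex-valued functions *)

Section complex_limits.
Context {R : realType}.
Local Notation C := R[i].

Lemma complex_ext (x y : C) : Re x = Re y -> Im x = Im y -> x = y.
Proof. by case: x y => [a b] [c d] /= -> ->. Qed.

Lemma reD (x y : C) : Re (x + y) = Re x + Re y.
Proof. by case: x; case: y. Qed.

Lemma imD (x y : C) : Im (x + y) = Im x + Im y.
Proof. by case: x; case: y. Qed.

Lemma reN (x : C) : Re (- x) = - Re x. Proof. by case: x. Qed.

Lemma imN (x : C) : Im (- x) = - Im x. Proof. by case: x. Qed.

Lemma reM (x y : C) : Re (x * y) = Re x * Re y - Im x * Im y.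
Proof. by case: x; case: y. Qed.

Lemma imM (x y : C) : Im (x * y) = Re x * Im y + Im x * Re y.
Proof. by case: x => a b; case: y => c d /=; ring. Qed.

Lemma reV (x : C) : Re x^-1 = Re x / (Re x ^+ 2 + Im x ^+ 2).
Proof. by case: x. Qed.

Lemma imV (x : C) : Im x^-1 = - (Im x / (Re x ^+ 2 + Im x ^+ 2)).
Proof. by case: x. Qed.

Lemma complex_eq0 (x : C) : (x == 0) = (Re x ^+ 2 + Im x ^+ 2 == 0).
Proof.
by case: x => a b; rewrite eq_complex /= paddr_eq0 ?sqr_ge0// !sqrf_eq0.
Qed.

Lemma normc_sqrt (x : C) : normc x = Num.sqrt (Re x ^+ 2 + Im x ^+ 2).
Proof. by case: x. Qed.

Lemma normc_ge0 (x : C) : 0 <= normc x.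
Proof. by rewrite normc_sqrt sqrtr_ge0. Qed.

Lemma normr_Re_le (x : C) : `|Re x| <= normc x.
Proof. by rewrite normc_sqrt -sqrtr_sqr ler_wsqrtr// lerDl sqr_ge0. Qed.

Lemma normr_Im_le (x : C) : `|Im x| <= normc x.
Proof. by rewrite normc_sqrt -sqrtr_sqr ler_wsqrtr// lerDr sqr_ge0. Qed.

Lemma normc_le (x : C) : normc x <= `|Re x| + `|Im x|.
Proof.
rewrite normc_sqrt -[leRHS]ger0_norm ?addr_ge0// -sqrtr_sqr ler_wsqrtr//.
rewrite sqrrD !real_normK ?num_real// lerD2r lerDl mulrn_wge0// mulr_ge0.
Qed.

Lemma normcX (x : C) n : normc (x ^+ n) = normc x ^+ n.
Proof.
by elim: n => [|n ih]; rewrite ?normc1// !exprS normcM ih.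
Qed.

Lemma normc_gt0 (x : C) : x != 0 -> 0 < normc x.
Proof.
move=> x0; rewrite lt_neqAle normc_ge0 andbT eq_sym.
by apply: contra x0 => /eqP /eq0_normc ->.
Qed.

Lemma normc_real (a : R) : normc a%:C = `|a|.
Proof. by rewrite normc_sqrt /= expr0n addr0 sqrtr_sqr. Qed.

(** Componentwise convergence reduces every limit in [R[i]] to limits in the
    normed module [R], and is compatible with the field operations. *)
Definition ccvg {T : Type} (F : set_system T) (f : T -> C) (l : C) :=
  (fun x => Re (f x)) @ F --> Re l /\ (fun x => Im (f x)) @ F --> Im l.

Section filter.
Context {T : Type} {F : set_system T} {FF : Filter F}.
Implicit Types (f g : T -> C) (k l : C).

Lemma ccvg_cst k : ccvg F (fun=> k) k.
Proof. by split; exact: cvg_cst. Qed.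

Lemma ccvgD f g k l :
  ccvg F f k -> ccvg F g l -> ccvg F (fun x => f x + g x) (k + l).
Proof.
move=> [f1 f2] [g1 g2]; split.
  by rewrite reD; under eq_fun do rewrite reD; exact: cvgD.
by rewrite imD; under eq_fun do rewrite imD; exact: cvgD.
Qed.

Lemma ccvgM f g k l :
  ccvg F f k -> ccvg F g l -> ccvg F (fun x => f x * g x) (k * l).
Proof.
move=> [f1 f2] [g1 g2]; split.
  rewrite reM; under eq_fun do rewrite reM.
  by apply: cvgB; exact: cvgM.
rewrite imM; under eq_fun do rewrite imM.
by apply: cvgD; exact: cvgM.
Qed.

Lemma ccvgB f g k l :
  ccvg F f k -> ccvg F g l -> ccvg F (fun x => f x - g x) (k - l).
Proof.
move=> fk gl; rewrite -(mulN1r l); under eq_fun do rewrite -mulN1r.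
by apply: ccvgD => //; apply: ccvgM => //; exact: ccvg_cst.
Qed.

Lemma ccvgV f k : k != 0 -> ccvg F f k -> ccvg F (fun x => (f x)^-1) k^-1.
Proof.
rewrite complex_eq0 => k0 [f1 f2].
have fn : (fun x => (Re (f x) ^+ 2 + Im (f x) ^+ 2)^-1) @ F -->
    (Re k ^+ 2 + Im k ^+ 2)^-1.
  apply: cvgV => //; under eq_fun do rewrite !expr2.
  by rewrite !expr2; apply: cvgD; exact: cvgM.
split.
  by rewrite reV; under eq_fun do rewrite reV; exact: cvgM.
rewrite imV; under eq_fun do rewrite imV.
by apply: cvgN; exact: cvgM.
Qed.

Lemma ccvg_near f g l : (\forall x \near F, g x = f x) ->
  ccvg F f l -> ccvg F g l.
Proof.
move=> gf [f1 f2]; split.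
  by apply: cvg_trans f1; apply: near_eq_cvg; apply: filterS gf => x ->.
by apply: cvg_trans f2; apply: near_eq_cvg; apply: filterS gf => x ->.
Qed.

Lemma ccvg_eq f g k l : f =1 g -> k = l -> ccvg F f k -> ccvg F g l.
Proof. by move=> /funext -> ->. Qed.

(** Both components are bounded by the modulus, and the modulus by the sum of
    their absolute values. *)
Lemma ccvg_normcP f l :
  ccvg F f l <-> (fun x => normc (f x - l)) @ F --> (0 : R).
Proof.
split=> [[f1 f2]|fl].
  apply: (@squeeze_cvgr _ _ _ _ (fun=> 0)
      (fun x => `|Re (f x) - Re l| + `|Im (f x) - Im l|)); last 2 first.
  - exact: cvg_cst.
  - rewrite -[X in _ --> X]addr0; apply: cvgD; apply/norm_cvg0P.
      rewrite -[X in _ --> X](subrr (Re l)).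
      by apply: cvgB => //; exact: cvg_cst.
    rewrite -[X in _ --> X](subrr (Im l)).
    by apply: cvgB => //; exact: cvg_cst.
  - apply: nearW => x; rewrite normc_ge0/= (le_trans (normc_le _))//.
    by rewrite reD imD reN imN.
split; apply/subr_cvg0; apply/norm_cvg0P.
  apply: (@squeeze_cvgr _ _ _ _ (fun=> 0) (fun x => normc (f x - l))) => //.
    by apply: nearW => x; rewrite normr_ge0/= -reN -reD normr_Re_le.
  exact: cvg_cst.
apply: (@squeeze_cvgr _ _ _ _ (fun=> 0) (fun x => normc (f x - l))) => //.
  by apply: nearW => x; rewrite normr_ge0/= -imN -imD normr_Im_le.
exact: cvg_cst.
Qed.

Lemma ccvg_near_lt f l e : 0 < e -> ccvg F f l ->
  \forall x \near F, normc (f x - l) < e.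
Proof.
move=> e0 /ccvg_normcP /cvgrPdist_lt /(_ _ e0).
apply: filterS => x; rewrite sub0r normrN ger0_norm//; exact: normc_ge0.
Qed.

Lemma ccvg_le f l (r : T -> R) : (\forall x \near F, normc (f x - l) <= r x) ->
  r @ F --> (0 : R) -> ccvg F f l.
Proof.
move=> fr r0; apply/ccvg_normcP.
apply: (@squeeze_cvgr _ _ _ _ (fun=> 0) r) => //; last exact: cvg_cst.
by apply: filterS fr => x; rewrite normc_ge0.
Qed.

End filter.

End complex_limits.

(** * Directional derivatives of complex-valued functions *)

Section complex_derivatives.
Context {R : realType} {V : normedModType R}.
Local Notation C := R[i].
Implicit Types (f g : V -> C) (x v : V) (d e : C).

(** With the difference quotient taken in [R[i]], the rules of calculus follow
    from field identities. *)
Definition cderive f x v d :=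
  ccvg 0^' (fun h : R => (h^-1)%:C * (f (h *: v + x) - f x)) d.

Lemma cderiveP f x v d : cderive f x v d <->
  is_derive x v (fun y => Re (f y)) (Re d) /\
  is_derive x v (fun y => Im (f y)) (Im d).
Proof.
have quotientE (p : C -> R) :
    (forall a y z, p (a%:C * (y - z)) = a * (p y - p z)) ->
    (fun h : R => p ((h^-1)%:C * (f (h *: v + x) - f x))) =
    (fun h => h^-1 *: (((fun y => p (f y)) \o shift x) (h *: v) - p (f x))).
  by move=> pE; apply/funext => h; rewrite pE.
have ReE a (y z : C) : Re (a%:C * (y - z)) = a * (Re y - Re z).
  by rewrite reM reD reN /= mul0r subr0.
have ImE a (y z : C) : Im (a%:C * (y - z)) = a * (Im y - Im z).
  by rewrite imM imD imN /= mul0r addr0.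
rewrite /cderive /ccvg (quotientE (@complex.Re R))//.
rewrite (quotientE (@complex.Im R))//.
split=> [[f1 f2]|[[f1 <-] [f2 <-]]]; last by split; [exact: f1|exact: f2].
split; first by split; [exact: cvgP f1|exact: cvg_lim f1].
by split; [exact: cvgP f2|exact: cvg_lim f2].
Qed.

(** Differentiability along [v] gives continuity along [v], which is all that
    the product and inverse rules need. *)
Lemma cderive_cvg f x v d : cderive f x v d ->
  ccvg (0 : R)^' (fun h : R => f (h *: v + x)) (f x).
Proof.
move=> fd.
have -> : f x = 0 * d + f x by rewrite mul0r add0r.
apply: (ccvg_near
  (f := fun h : R => h%:C * ((h^-1)%:C * (f (h *: v + x) - f x)) + f x)).
  near=> h; rewrite mulrA -rmorphM/= divff; first by rewrite mul1r subrK.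
  near: h; exact: nbhs_dnbhs_neq.
apply: ccvgD; last exact: ccvg_cst.
apply: ccvgM => //; split => /=; last exact: cvg_cst.
apply: cvg_within.
Unshelve. all: by end_near. Qed.

Lemma cderive_eq f g x v d e : f =1 g -> d = e ->
  cderive f x v d -> cderive g x v e.
Proof. by move=> /funext -> ->. Qed.

Lemma cderive_cst k x v : cderive (fun=> k) x v 0.
Proof.
by rewrite /cderive subrr; under eq_fun do rewrite mulr0; exact: ccvg_cst.
Qed.

Lemma cderiveD f g x v d e : cderive f x v d -> cderive g x v e ->
  cderive (fun y => f y + g y) x v (d + e).
Proof. by move=> fd ge; apply: ccvg_eq (ccvgD fd ge) => // h; ring. Qed.

Lemma cderiveM f g x v d e : cderive f x v d -> cderive g x v e ->
  cderive (fun y => f y * g y) x v (d * g x + f x * e).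
Proof.
move=> fd ge.
apply: ccvg_eq (ccvgD (ccvgM fd (cderive_cvg ge))
  (ccvgM (ccvg_cst (f x)) ge)) => //.
by move=> h; ring.
Qed.

Lemma cderiveZ k f x v d : cderive f x v d ->
  cderive (fun y => k * f y) x v (k * d).
Proof.
by move=> fd; have := cderiveM (cderive_cst k x v) fd; rewrite mul0r add0r.
Qed.

Lemma cderiveB f g x v d e : cderive f x v d -> cderive g x v e ->
  cderive (fun y => f y - g y) x v (d - e).
Proof.
move=> fd ge; rewrite -(mulN1r e); under eq_fun do rewrite -mulN1r.
exact/cderiveD/cderiveZ.
Qed.

(** The chain rule in Caratheodory's form: the increment of [g] is that of [f]
    times a slope that converges. *)
Lemma cderive_slope f g (s : R -> C) x v d m : cderive f x v d ->
  (\forall h \near 0^', g (h *: v + x) - g x = (f (h *: v + x) - f x) * s h) ->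
  ccvg 0^' s m -> cderive g x v (d * m).
Proof.
move=> fd gs sm; apply: ccvg_near (ccvgM fd sm).
by apply: filterS gs => h ->; rewrite mulrA.
Qed.

Lemma cderiveV f x v d : f x != 0 -> cderive f x v d ->
  cderive (fun y => (f y)^-1) x v (d * - (f x)^-2).
Proof.
move=> fx0 fd; have fc := cderive_cvg fd.
apply: (cderive_slope (s := fun h => - ((f (h *: v + x))^-1 * (f x)^-1)) fd).
  have : \forall h \near (0 : R)^', normc (f (h *: v + x) - f x) < normc (f x).
    by apply: ccvg_near_lt => //; exact: normc_gt0.
  apply: filterS => h fh; have fh0 : f (h *: v + x) != 0.
    by apply: contraTN fh => /eqP ->; rewrite sub0r normcN ltxx.
  by field; rewrite fh0 fx0.
rewrite expr2 invfM -mulN1r; under eq_fun do rewrite -mulN1r.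
apply: ccvgM; first exact: ccvg_cst.
by apply: ccvgM; [exact: ccvgV|exact: ccvg_cst].
Qed.

Lemma cderiveX f x v d n : cderive f x v d ->
  cderive (fun y => f y ^+ n.+1) x v (d * (n.+1%:R * f x ^+ n)).
Proof.
move=> fd; elim: n => [|n ih].
  by rewrite mul1r expr0 mulr1; apply: cderive_eq fd.
apply: cderive_eq (cderiveM fd ih) => [y|]; first by rewrite -exprS.
by rewrite -(natr1 n.+1) exprS; ring.
Qed.

End complex_derivatives.

(** * Primitives and integrals over [0, 1] *)

Section complex_integral.
Context {R : realType}.
Local Notation C := R[i].
Implicit Types (f df F : R -> C) (t : R).

Lemma cderive_real (f df : R -> R) (t : R) : is_derive t 1 f (df t) ->
  cderive (fun t => (f t)%:C) t 1 (df t)%:C.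
Proof. by move=> fd; apply/cderiveP; split=> //=; exact: is_derive_cst. Qed.

Lemma MVT01 (g dg : R -> R) :
  (forall t : R, t \in `[0, 1] -> is_derive t 1 g (dg t)) ->
  exists2 c : R, c \in `[0, 1] & g 1 - g 0 = dg c.
Proof.
move=> gd; have gc : {within `[0, 1], continuous g}.
  by apply: derivable_within_continuous => t t01; have [] := gd _ t01.
have gd' (t : R) : t \in `]0, 1[ -> is_derive t 1 g (dg t).
  by move=> t01; apply: gd; exact: subset_itv_oo_cc.
have [c c01 gE] := @MVT_segment R g dg 0 1 ler01 gd' gc.
by exists c => //; rewrite gE subr0 mulr1.
Qed.

(** The mean value theorem fails for complex values; the factor 2 comes from
    its application to each component. *)
Lemma mean_value_normc f df B :
  (forall t, t \in `[0, 1] -> cderive f t 1 (df t)) ->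
  (forall t, t \in `[0, 1] -> normc (df t) <= B) ->
  normc (f 1 - f 0) <= B *+ 2.
Proof.
move=> fd dfB.
have mvt (p : C -> R) : (forall t, t \in `[0, 1] ->
    is_derive t 1 (fun y => p (f y)) (p (df t))) ->
    (forall z, `|p z| <= normc z) -> `|p (f 1) - p (f 0)| <= B.
  move=> pd pn.
  have [c c01 ->] := MVT01 pd.
  by rewrite (le_trans (pn _))// dfB.
rewrite (le_trans (normc_le _))// mulr2n lerD// ?reD ?reN ?imD ?imN.
  apply: (mvt (@complex.Re R)); last exact: normr_Re_le.
  by move=> t /fd /cderiveP[].
apply: (mvt (@complex.Im R)); last exact: normr_Im_le.
by move=> t /fd /cderiveP[].
Qed.

Lemma derivable_bounded f df :
  (forall t, t \in `[0, 1] -> cderive f t 1 (df t)) ->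
  exists2 B, 0 <= B & forall t, t \in `[0, 1] -> normc (f t) <= B.
Proof.
move=> fd.
have bnd (p : C -> R) : (forall t, t \in `[0, 1] ->
    is_derive t 1 (fun y => p (f y)) (p (df t))) ->
    exists B, forall t, t \in `[0, 1] -> `|p (f t)| <= B.
  move=> pd.
  have pc : {within `[0, 1], continuous (fun y => `|p (f y)|)}.
    suff pc : {within `[0, 1], continuous (fun y => p (f y))}.
      by move=> x; apply: cvg_norm; exact: pc.
    apply: derivable_within_continuous => t t01; by have [] := pd _ t01.
  by have [c _ cmax] := EVT_max ler01 pc; exists `|p (f c)|.
have [|B1 fB1] := bnd (@complex.Re R); first by move=> t /fd /cderiveP[].
have [|B2 fB2] := bnd (@complex.Im R); first by move=> t /fd /cderiveP[].
have fB t : t \in `[0, 1] -> normc (f t) <= B1 + B2.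
  by move=> t01; rewrite (le_trans (normc_le _))// lerD ?fB1 ?fB2.
exists (B1 + B2) => //; apply: le_trans (fB 0 _); first exact: normc_ge0.
by rewrite in_itv/= lexx ler01.
Qed.


(** The fundamental theorem of calculus holds in the interior of the domain of
    integration: starting at -1 makes 0 and 1 interior points. *)
Lemma real_primitive (g : R -> R) : continuous g ->
  exists G : R -> R, forall t : R, t \in `[0, 1] -> is_derive t 1 G (g t).
Proof.
move=> gc.
exists (fun t : R => \int[@lebesgue_measure R]_(s in `[-1, t]) g s)%R => t.
rewrite in_itv/= => /andP[t0 t1].
have gi : (@lebesgue_measure R).-integrable `[(-1 : R), 2] (EFin \o g).
  apply: continuous_compact_integrable; first exact: segment_compact.
  exact: continuous_subspaceT.
have t2 : t < 2 by rewrite (le_lt_trans t1)// ltr1n.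
have tN1 : -1 < t by rewrite (lt_le_trans _ t0)// ltrN10.
have [dG <-] := continuous_FTC1_closed t2 gi tN1 (gc t).
by rewrite derive1E; exact: derivableP.
Qed.

(** The integral over [0, 1], through primitives: only its linearity and the
    mean value bound are needed, and both are statements about derivatives. *)
Definition cintegral f : C :=
  let F := xget (fun=> 0)
    [set F : R -> C | forall t : R, t \in `[0, 1] -> cderive F t 1 (f t)] in
  F 1 - F 0.

Definition ccontinuous f := forall t, ccvg (nbhs t) f (f t).

Lemma primitive_ex f : ccontinuous f ->
  exists F, forall t : R, t \in `[0, 1] -> cderive F t 1 (f t).
Proof.
move=> fc.
have [A Ad] : exists A : R -> R, forall t : R, t \in `[0, 1] ->
    is_derive t 1 A (Re (f t)).
  by apply: real_primitive => t; have [] := fc t.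
have [B Bd] : exists B : R -> R, forall t : R, t \in `[0, 1] ->
    is_derive t 1 B (Im (f t)).
  by apply: real_primitive => t; have [] := fc t.
exists (fun t => A t +i* B t) => t t01.
by apply/cderiveP; split; [exact: Ad|exact: Bd].
Qed.

(** Two primitives differ by a function of zero derivative, so the choice in
    [cintegral] is harmless. *)
Lemma cintegral_primitive f F :
  (forall t : R, t \in `[0, 1] -> cderive F t 1 (f t)) ->
  cintegral f = F 1 - F 0.
Proof.
move=> Fd; rewrite /cintegral; case: xgetP => [G _ Gd|/(_ F)//].
have GF (t : R) : t \in `[0, 1] -> cderive (fun t => G t - F t) t 1 0.
  by move=> t01; rewrite -(subrr (f t)); apply: cderiveB; [exact: Gd|exact: Fd].
have : normc (G 1 - F 1 - (G 0 - F 0)) <= 0 *+ 2.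
  by apply: (mean_value_normc GF) => t _; rewrite normc0.
rewrite mul0rn => GF0.
have /eq0_normc/eqP : normc (G 1 - F 1 - (G 0 - F 0)) = 0.
  by apply/eqP; rewrite eq_le GF0 normc_ge0.
by rewrite subr_eq0 => /eqP GF1; rewrite -(subrK (F 1) (G 1)) GF1; ring.
Qed.

Lemma cintegral_cst (k : C) : cintegral (fun=> k) = k.
Proof.
rewrite (@cintegral_primitive _ (fun t : R => k * t%:C)).
  by rewrite mulr1 mulr0 subr0.
move=> t _; rewrite -[k in X in cderive _ _ _ X]mulr1.
by apply: cderiveZ; apply: (cderive_real (df := fun=> 1)); exact: is_derive_id.
Qed.

Lemma cintegralZ (k : C) f : ccontinuous f ->
  cintegral (fun t => k * f t) = k * cintegral f.
Proof.
move=> /primitive_ex[F Fd]; rewrite (cintegral_primitive Fd).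
rewrite (@cintegral_primitive _ (fun t => k * F t)); first by rewrite mulrBr.
by move=> t t01; exact/cderiveZ/Fd.
Qed.

Lemma cintegralB f g : ccontinuous f -> ccontinuous g ->
  cintegral (fun t => f t - g t) = cintegral f - cintegral g.
Proof.
move=> /primitive_ex[F Fd] /primitive_ex[G Gd].
rewrite (cintegral_primitive Fd) (cintegral_primitive Gd).
rewrite (@cintegral_primitive _ (fun t => F t - G t)); first by ring.
by move=> t t01; apply: cderiveB; [exact: Fd|exact: Gd].
Qed.

Lemma cintegral_conj f : ccontinuous f ->
  cintegral (fun t => (f t)^*) = (cintegral f)^*.
Proof.
move=> /primitive_ex[F Fd]; rewrite (cintegral_primitive Fd).
rewrite (@cintegral_primitive _ (fun t => (F t)^*)); first by rewrite rmorphB.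
move=> t /Fd /cderiveP[F1 F2]; apply/cderiveP.
have -> : (fun y => Re (F y)^*) = (fun y => Re (F y)).
  by apply/funext => y; case: (F y).
have -> : (fun y => Im (F y)^*) = - (fun y => Im (F y)).
  by apply/funext => y; rewrite fctE; case: (F y).
have [-> ->] : Re (f t)^* = Re (f t) /\ Im (f t)^* = - Im (f t) by case: (f t).
by split => //; exact: is_deriveN.
Qed.

Lemma normc_cintegral f B : ccontinuous f ->
  (forall t : R, t \in `[0, 1] -> normc (f t) <= B) ->
  normc (cintegral f) <= B *+ 2.
Proof.
move=> /primitive_ex[F Fd] fB; rewrite (cintegral_primitive Fd).
exact: mean_value_normc Fd fB.
Qed.

End complex_integral.

(** * The function arccos u / sqrt (1 - u^2) on the slit plane *)

Section arccos_ratio.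
Context {R : realType}.
Local Notation C := R[i].
Implicit Types (u v w : C) (t : R).

(** The function [(1 - t^2) / 2] of [0, 1], extended by 0 so that [kernel] has
    no zero at any real [t] when [u] is off the cut. *)
Definition weight t : R := Num.max 0 ((1 - t ^+ 2) / 2).

Lemma weight_ge0 t : 0 <= weight t.
Proof. by rewrite /weight le_max lexx. Qed.

Lemma weight_le t : weight t <= 2^-1.
Proof.
rewrite /weight ge_max invr_ge0 ler0n/= ler_pdivrMr ?ltr0n// mulVf ?pnatr_eq0//.
by rewrite lerBlDr lerDl sqr_ge0.
Qed.

Lemma weightE t : t \in `[0, 1] -> weight t = (1 - t ^+ 2) / 2.
Proof.
rewrite in_itv/= => /andP[t0 t1]; apply/max_idPr.
by rewrite divr_ge0// subr_ge0 expr_le1.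
Qed.

Lemma weight_continuous : continuous weight.
Proof.
have -> : weight = fun t : R => ((1 - t ^+ 2) / 2 + `|(1 - t ^+ 2) / 2|) / 2.
  apply/funext => t; rewrite /weight; set x := (1 - t ^+ 2) / 2.
  case: (leP 0 x) => x0; first by rewrite ger0_norm//; field.
  by rewrite ltr0_norm// subrr mul0r.
move=> t; apply: cvgMl.
have pc : {for t, continuous (fun t : R => (1 - t ^+ 2) / 2)}.
  apply: cvgMl; apply: cvgB; first exact: cvg_cst.
  exact: exprn_continuous.
by apply: cvgD => //; exact: cvg_norm.
Qed.

Definition kernel u t : C := 1 - (weight t)%:C * (1 - u).

(** The domain in which the integrals below make sense; it contains the slit
    plane. *)
Definition pole_free u := forall t, kernel u t != 0.

Definition off_cut u := ~ (Im u = 0 /\ Re u <= -1).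

Lemma kernelB u v t : kernel u t - kernel v t = (weight t)%:C * (u - v).
Proof. by rewrite /kernel; ring. Qed.

Lemma normc_kernelB u v t : normc (kernel u t - kernel v t) <= normc (u - v).
Proof.
rewrite kernelB normcM normc_real ger0_norm ?weight_ge0// ler_piMl ?normc_ge0//.
by rewrite (le_trans (weight_le t))// invf_le1 ?ltr0n// ler1n.
Qed.

(** The zeros of the kernel are at [u = 1 - 1 / weight t], which is at most -1
    since the weight is at most 1/2.  A bound uniform in [t] makes the integrals
    continuous in [u]. *)
Lemma kernel_lower u : off_cut u ->
  exists2 m : R, 0 < m & forall t, m <= normc (kernel u t).
Proof.
case: u => a b cut.
have RekE t : Re (kernel (a +i* b) t) = 1 - weight t * (1 - a).
  by rewrite /kernel reD reN reM /= mul0r subr0.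
have ImkE t : Im (kernel (a +i* b) t) = weight t * b.
  by rewrite /kernel imD imN imM /= mul0r addr0; ring.
have [b0|b0] := eqVneq b 0.
  have a1 : -1 < a by rewrite ltNge; apply/negP => a1; apply: cut.
  exists (Num.min 1 ((1 + a) / 2)) => [|t].
    by rewrite lt_min ltr01/= divr_gt0 ?ltr0n//; lra.
  rewrite (le_trans _ (normr_Re_le _))// (le_trans _ (ler_norm _))// RekE.
  have := weight_ge0 t; have := weight_le t; set c := weight t => c1 c0.
  rewrite ge_min; case: (leP 1 a) => a1'; apply/orP; [left|right]; nra.
have n0 : 0 < (1 - a) ^+ 2 + b ^+ 2.
  by rewrite ltr_wpDl ?sqr_ge0// exprn_even_gt0//= b0.
exists (Num.sqrt (b ^+ 2 / ((1 - a) ^+ 2 + b ^+ 2))) => [|t].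
  by rewrite sqrtr_gt0 divr_gt0// exprn_even_gt0//= b0.
rewrite normc_sqrt ler_wsqrtr// RekE ImkE; set c := weight t.
(* the quadratic polynomial in the weight is completed to a square *)
rewrite ler_pdivrMr// -subr_ge0.
have -> : ((1 - c * (1 - a)) ^+ 2 + (c * b) ^+ 2) * ((1 - a) ^+ 2 + b ^+ 2) -
    b ^+ 2 = (c * ((1 - a) ^+ 2 + b ^+ 2) - (1 - a)) ^+ 2 by ring.
exact: sqr_ge0.
Qed.

Lemma pole_free_lower u m : 0 < m -> (forall t, m <= normc (kernel u t)) ->
  pole_free u.
Proof.
move=> m0 um t; apply: contraTneq (um t) => ->.
by rewrite normc0 -ltNge.
Qed.

Lemma off_cut_pole_free u : off_cut u -> pole_free u.
Proof. by move=> /kernel_lower[m m0]; exact: pole_free_lower. Qed.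

Lemma kernel_near u v m : (forall t, m <= normc (kernel u t)) ->
  normc (v - u) <= m / 2 -> forall t, m / 2 <= normc (kernel v t).
Proof.
move=> um vu t.
have := le_trans (normc_kernelB u v t) (_ : _ <= m / 2).
rewrite -normcN opprB => /(_ vu) uv.
have := le_normcD (kernel u t - kernel v t) (kernel v t).
rewrite subrK => /(le_trans (um t)).
move: uv; lra.
Qed.

Lemma ccontinuous_kernelV u :
  pole_free u -> ccontinuous (fun t => (kernel u t)^-1).
Proof.
move=> u0 t; apply: ccvgV => //; apply: ccvgB; first exact: ccvg_cst.
apply: ccvgM; last exact: ccvg_cst.
by split => /=; [exact: weight_continuous|exact: cvg_cst].
Qed.

(** With u = cos s this is s / sin s, that is arccos u / sqrt (1 - u^2).  The
    integral is regular at u = 1, where the quotient is a removable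
    singularity. *)
Definition arccos_ratio u : C := cintegral (fun t => (kernel u t)^-1).

(** The opposite of the divided difference of [arccos_ratio]. *)
Definition slope u v : C :=
  cintegral (fun t => (weight t)%:C * ((kernel u t)^-1 * (kernel v t)^-1)).

Lemma ccontinuous_slope u v : pole_free u -> pole_free v ->
  ccontinuous (fun t => (weight t)%:C * ((kernel u t)^-1 * (kernel v t)^-1)).
Proof.
move=> u0 v0 t; apply: ccvgM.
  by split => /=; [exact: weight_continuous|exact: cvg_cst].
by apply: ccvgM; exact: ccontinuous_kernelV.
Qed.

(** The kernel is affine in [u], so the difference of its inverses has an
    explicit factor [u - v]. *)
Lemma arccos_ratioB u v : pole_free u -> pole_free v ->
  arccos_ratio u - arccos_ratio v = (u - v) * - slope u v.
Proof.
move=> u0 v0; rewrite /arccos_ratio -cintegralB; try exact: ccontinuous_kernelV.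
rewrite mulrN -mulNr -cintegralZ; last exact: ccontinuous_slope.
congr cintegral; apply/funext => t.
have -> : - (u - v) * ((weight t)%:C * ((kernel u t)^-1 * (kernel v t)^-1)) =
    (kernel v t - kernel u t) * ((kernel u t)^-1 * (kernel v t)^-1).
  by rewrite kernelB; ring.
by field; rewrite u0 v0.
Qed.

(** The ball of radius [m / 2] around [w] keeps the kernel above [m / 2], and
    the difference of the products of its inverses is telescoped. *)
Lemma slope_diff u v w m : 0 < m -> (forall t, m <= normc (kernel w t)) ->
  normc (u - w) <= m / 2 -> normc (v - w) <= m / 2 ->
  normc (slope u v - slope w w) <=
    (m / 2) ^- 3 *+ 2 * (normc (u - w) + normc (v - w)).
Proof.
move=> m0 wm uw vw.
have um := kernel_near wm uw; have vm := kernel_near wm vw.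
have m20 : 0 < m / 2 by rewrite divr_gt0.
have u0 := pole_free_lower m20 um; have v0 := pole_free_lower m20 vm.
have w0 := pole_free_lower m0 wm.
have wm2 t : m / 2 <= normc (kernel w t).
  by apply: le_trans (wm t); move: m0; lra.
have invB z (t : R) : (forall t, m / 2 <= normc (kernel z t)) ->
    normc (kernel z t)^-1 <= (m / 2)^-1.
  move=> zm; rewrite normcV lef_pV2 ?posrE//.
  exact: lt_le_trans m20 (zm t).
rewrite mulrnAl; rewrite /slope -cintegralB; try exact: ccontinuous_slope.
apply: normc_cintegral => [t|t _].
  by apply: ccvgB; exact: ccontinuous_slope.
have -> : (weight t)%:C * ((kernel u t)^-1 * (kernel v t)^-1) -
    (weight t)%:C * ((kernel w t)^-1 * (kernel w t)^-1) =
    (weight t)%:C * ((kernel u t)^-1 * (kernel v t)^-1 * (kernel w t)^-1 *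
      (kernel w t - kernel u t) + (kernel v t)^-1 * (kernel w t)^-1 *
      (kernel w t)^-1 * (kernel w t - kernel v t)).
  by field; rewrite u0 v0 w0.
rewrite normcM normc_real ger0_norm ?weight_ge0//.
rewrite (le_trans (ler_piMl (normc_ge0 _) (le_trans (weight_le t) _)))//.
  by rewrite invf_le1 ?ltr0n// ler1n.
rewrite (le_trans (le_normcD _ _))// [leRHS]mulrDr lerD// normcM.
  apply: ler_pM; rewrite ?normc_ge0//; last first.
    by rewrite -normcN opprB normc_kernelB.
  rewrite !normcM -exprVn !exprS expr0 mulr1 mulrA.
  by do 2 (apply: ler_pM; rewrite ?mulr_ge0 ?normc_ge0 ?invB//).
apply: ler_pM; rewrite ?normc_ge0//; last first.
  by rewrite -normcN opprB normc_kernelB.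
rewrite !normcM -exprVn !exprS expr0 mulr1 mulrA.
by do 2 (apply: ler_pM; rewrite ?mulr_ge0 ?normc_ge0 ?invB//).
Qed.

Lemma pole_free_cvg (T : Type) (F : set_system T) (f : T -> C) w :
  Filter F -> off_cut w -> ccvg F f w -> \forall x \near F, pole_free (f x).
Proof.
move=> FF /kernel_lower[m m0 wm] fw.
have m20 : 0 < m / 2 by rewrite divr_gt0.
apply: filterS (ccvg_near_lt m20 fw) => x /ltW fx.
exact: pole_free_lower m20 (kernel_near wm fx).
Qed.

Lemma slope_cvg (T : Type) (F : set_system T) (f g : T -> C) w :
  Filter F -> off_cut w -> ccvg F f w -> ccvg F g w ->
  ccvg F (fun x => slope (f x) (g x)) (slope w w).
Proof.
move=> FF /kernel_lower[m m0 wm] fw gw.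
have m20 : 0 < m / 2 by rewrite divr_gt0.
apply: (ccvg_le (r := fun x => (m / 2) ^- 3 *+ 2 *
  (normc (f x - w) + normc (g x - w)))).
  apply: filterS2 (ccvg_near_lt m20 fw) (ccvg_near_lt m20 gw).
  by move=> x /ltW fx /ltW gx; exact: slope_diff.
rewrite -[X in _ --> X](mulr0 ((m / 2) ^- 3 *+ 2)); apply: cvgMr.
rewrite -[X in _ --> X](addr0 0).
by apply: cvgD; exact/ccvg_normcP.
Qed.

(** The symmetry required of stem functions: the weight is real. *)
Lemma arccos_ratio_conj u : pole_free u ->
  arccos_ratio u^* = (arccos_ratio u)^*.
Proof.
move=> u0; rewrite -cintegral_conj; last exact: ccontinuous_kernelV.
congr cintegral; apply/funext => t.
rewrite fmorphV; congr (_^-1); rewrite /kernel !(rmorphB,rmorphM,rmorph1).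
by rewrite /= oppr0.
Qed.

Lemma arccos_ratio1 : arccos_ratio 1 = 1.
Proof.
rewrite /arccos_ratio -[RHS]cintegral_cst; congr cintegral; apply/funext => t.
by rewrite /kernel subrr mulr0 subr0 invr1.
Qed.

End arccos_ratio.

(** * The exponential series along the logarithm *)

Section exponential.
Context {R : realType}.
Local Notation C := R[i].
Implicit Types (u s y z : C) (t : R).

Definition exp_sum N y : C := \sum_(n < N) y ^+ n / n`!%:R.

Lemma exp_sumS N y : exp_sum N.+1 y = exp_sum N y + y ^+ N / N`!%:R.
Proof. by rewrite /exp_sum big_ord_recr. Qed.

Lemma exp_sum_cderive N (f : R -> C) t d : cderive f t 1 d ->
  cderive (fun t => exp_sum N.+1 (f t)) t 1 (d * exp_sum N (f t)).
Proof.
move=> fd; elim: N => [|N ih].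
  apply: cderive_eq (cderive_cst 1 t 1) => [r|].
    by rewrite exp_sumS /exp_sum big_ord0 expr0 divr1 add0r.
  by rewrite /exp_sum big_ord0 mulr0.
apply: cderive_eq (cderiveD ih (cderiveZ (N.+1`!%:R^-1) (cderiveX N fd))).
  by move=> r; rewrite [in RHS]exp_sumS [_ / _]mulrC.
rewrite [in RHS]exp_sumS factS natrM invfM.
have N0 : N.+1%:R != 0 :> C by rewrite pnatr_eq0.
have fN0 : N`!%:R != 0 :> C by rewrite pnatr_eq0 -lt0n fact_gt0.
move: N.+1%:R N`!%:R N0 fN0 => a b a0 b0.
by field; rewrite a0 b0.
Qed.

(** If [G' = y' G], the derivative of [exp_sum N.+1 (- y) * G] telescopes to
    [y' G (- y)^N / N!], which tends to 0 uniformly on [0, 1]. *)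
Lemma exp_sum_cvg (y dy G : R -> C) : y 0 = 0 ->
  (forall t : R, t \in `[0, 1] -> cderive y t 1 (dy t)) ->
  (forall t : R, t \in `[0, 1] -> cderive G t 1 (dy t * G t)) ->
  (exists2 B, 0 <= B & forall t : R, t \in `[0, 1] -> normc (dy t) <= B) ->
  G 1 != 0 ->
  ccvg \oo (fun N => exp_sum N (- y 1)) (G 0 / G 1).
Proof.
move=> y0 yd Gd [B1 B10 dyB] G10.
have [B2 B20 yB] := derivable_bounded yd.
have [B3 B30 GB] := derivable_bounded Gd.
have Hd N (t : R) : t \in `[0, 1] ->
    cderive (fun t => exp_sum N.+1 (- y t) * G t) t 1
            (dy t * G t * (- y t) ^+ N / N`!%:R).
  move=> t01; have nyd := cderiveZ (-1) (yd t t01).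
  apply: cderive_eq (cderiveM (exp_sum_cderive N nyd) (Gd t t01)) => [r|].
    by rewrite mulN1r.
  by rewrite !mulN1r exp_sumS; ring.
have HB N : normc (exp_sum N.+1 (- y 1) * G 1 - G 0) <=
    (B1 * B3 * exp_coeff B2 N) *+ 2.
  have := @mean_value_normc _ _ _ (B1 * B3 * exp_coeff B2 N) (Hd N).
  have -> : exp_sum N.+1 (- y 0) = 1.
    rewrite y0 oppr0 /exp_sum big_ord_recl expr0 divr1 big1 ?addr0// => n _.
    by rewrite lift0 expr0n mul0r.
  rewrite mul1r; apply=> t t01.
  rewrite !normcM normcX normcN normcV.
  have -> : normc (N`!%:R : C) = N`!%:R.
    by rewrite -(rmorph_nat (real_complex R)) normc_real ger0_norm.
  rewrite /exp_coeff /= -mulrA ler_pM//.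
  - by rewrite mulr_ge0 ?normc_ge0.
  - by rewrite mulr_ge0 ?invr_ge0 ?exprn_ge0 ?normc_ge0.
  - by rewrite ler_pM ?normc_ge0 ?dyB ?GB.
  - by rewrite ler_wpM2r ?invr_ge0// lerXn2r ?nnegrE ?normc_ge0 ?yB.
have HG : ccvg \oo (fun N => exp_sum N.+1 (- y 1) * G 1) (G 0).
  apply: (ccvg_le (r := fun N => (B1 * B3 * exp_coeff B2 N) *+ 2)).
    by apply: nearW => N; exact: HB.
  rewrite -[X in _ --> X](mul0rn _ 2) -(mulr0 (B1 * B3)); apply: cvgMn.
  by apply: cvgMr; exact: cvg_exp_coeff.
have HG1 : ccvg \oo (fun N => exp_sum N.+1 (- y 1)) (G 0 / G 1).
  apply: ccvg_eq (ccvgM HG (ccvg_cst (G 1)^-1)) => // N.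
  by rewrite mulfK.
by case: HG1 => h1 h2; split; rewrite -cvg_shiftS.
Qed.

(** The partial fraction decomposition of the kernel in the variable [t]. *)
Lemma kernel_factor u s t : s ^+ 2 = 1 - u ^+ 2 -> t \in `[0, 1] ->
  (1 + u + 'i * s * t%:C) * (1 + u - 'i * s * t%:C) = 2 * (1 + u) * kernel u t.
Proof.
move=> s2 t01; rewrite mulrC -subr_sqr !exprMn sqr_i s2 /kernel weightE//.
have -> : ((1 - t ^+ 2) / 2)%:C = (1 - t%:C ^+ 2) / 2 :> C.
  by rewrite rmorphM rmorphB rmorph1 rmorphXn fmorphV rmorph_nat.
by field.
Qed.

Lemma off_cut_1D u : off_cut u -> 1 + u != 0.
Proof.
move=> uc; apply/eqP => u1; apply: uc.
have -> : u = -1 by rewrite -(addKr 1 u) u1 addr0.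
by rewrite reN imN /= oppr0.
Qed.

(** [s * arccos_ratio u] is a value of arccos at [u], at which the sine is [s].
    The rational function [P / Q] below plays the part of the exponential of the
    primitive [y]: it has the same logarithmic derivative by [kernel_factor],
    the value 1 at 0 and the value [u + i s] at 1. *)
Lemma exp_sum_arccos_ratio u s : off_cut u -> s ^+ 2 = 1 - u ^+ 2 ->
  ccvg \oo (fun N => exp_sum N (- ('i * s * arccos_ratio u))) (u - 'i * s).
Proof.
move=> uc s2; have u0 := off_cut_pole_free uc; have u1 := off_cut_1D uc.
have [k kd] := primitive_ex (ccontinuous_kernelV u0).
have isd t : cderive (fun t => 'i * s * t%:C) t 1 ('i * s).
  rewrite -[X in cderive _ _ _ X]mulr1; apply: cderiveZ.
  by apply: (cderive_real (df := fun=> 1)); exact: is_derive_id.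
pose P t : C := 1 + u + 'i * s * t%:C; pose Q t : C := 1 + u - 'i * s * t%:C.
have PQ t : t \in `[0, 1] -> P t * Q t = 2 * (1 + u) * kernel u t.
  exact: kernel_factor.
have Q0 t : t \in `[0, 1] -> Q t != 0.
  move=> t01; have : P t * Q t != 0.
    by rewrite PQ// !mulf_neq0// pnatr_eq0.
  by rewrite mulf_eq0 negb_or => /andP[].
have Pd t : cderive P t 1 ('i * s).
  rewrite -[X in cderive _ _ _ X]add0r.
  by apply: cderiveD => //; exact: cderive_cst.
have Qd t : cderive Q t 1 (- ('i * s)).
  rewrite -[X in cderive _ _ _ X]sub0r.
  by apply: cderiveB => //; exact: cderive_cst.
pose y t := 'i * s * (k t - k 0).
have yd (t : R) : t \in `[0, 1] -> cderive y t 1 ('i * s * (kernel u t)^-1).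
  move=> t01; apply: cderiveZ; rewrite -[X in cderive _ _ _ X]subr0.
  by apply: cderiveB; [exact: kd|exact: cderive_cst].
have [m m0 um] := kernel_lower uc.
have t1in : (1 : R) \in `[0, 1] by rewrite in_itv/= ler01 lexx.
have P1Q1 : P 1 * (u - 'i * s) = Q 1.
  rewrite /P /Q !mulr1.
  have -> : (1 + u + 'i * s) * (u - 'i * s) =
      u + u ^+ 2 - 'i * s - 'i ^+ 2 * s ^+ 2.
    by ring.
  by rewrite sqr_i s2; ring.
have P10 : P 1 != 0.
  by apply: contraNneq (Q0 _ t1in) => P10; rewrite -P1Q1 P10 mul0r.
have := @exp_sum_cvg y _ (fun t => P t / Q t) _ yd.
have -> : P 0 / Q 0 / (P 1 / Q 1) = u - 'i * s.
  rewrite /= -P1Q1 /P /Q !mulr0 addr0 subr0 divff// mul1r invfM invrK.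
  by rewrite mulrA mulVf// mul1r.
have -> : y 1 = 'i * s * arccos_ratio u.
  by rewrite /y /arccos_ratio (cintegral_primitive kd).
apply.
- by rewrite /y subrr mulr0.
- move=> t t01; have QVd := cderiveV (Q0 t t01) (Qd t).
  apply: cderive_eq (cderiveM (Pd t) QVd) => //.
  have -> : kernel u t = P t * Q t / (2 * (1 + u)).
    by rewrite PQ// mulrAC divff ?mul1r// mulf_neq0// pnatr_eq0.
  have : Q t + P t = 2 * (1 + u) by rewrite /P /Q; ring.
  have [P0|P0] := eqVneq (P t) 0.
    move: (PQ _ t01); rewrite P0 mul0r => /esym/eqP.
    by rewrite !mulf_eq0 pnatr_eq0 (negPf u1) (negPf (u0 t)).
  move=> <-; have Qt0 := Q0 t t01.
  have PQ0 : Q t + P t != 0.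
    by rewrite (_ : _ + _ = 2 * (1 + u)) ?mulf_neq0 ?pnatr_eq0// /P /Q; ring.
  by field; rewrite P0 Qt0 PQ0.
- exists (normc ('i * s) / m); first by rewrite divr_ge0 ?normc_ge0 ?ltW.
  move=> t _; rewrite normcM ler_wpM2l ?normc_ge0// normcV lef_pV2 ?posrE//.
  exact: lt_le_trans (um t).
- by rewrite mulf_neq0 ?invr_eq0 ?Q0.
Qed.

(** The powers of [k V] on the basis [1, V], when [V ^+ 2 = - (1 - u ^+ 2)]. *)
Definition exp_coefs u k n : C * C :=
  iter n (fun p => (- (k * (1 - u ^+ 2) * p.2), k * p.1)) (1, 0).

(** The evaluation of [V] at the complex number [i s]. *)
Lemma exp_coefs_pow u k s n : s ^+ 2 = 1 - u ^+ 2 ->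
  (exp_coefs u k n).1 + 'i * s * (exp_coefs u k n).2 = ('i * s * k) ^+ n.
Proof.
move=> s2; elim: n => [|n ih]; first by rewrite /= mulr0 addr0 expr0.
rewrite exprS -ih /= -s2.
have -> : 'i * s * k * ((exp_coefs u k n).1 + 'i * s * (exp_coefs u k n).2) =
  'i * s * (k * (exp_coefs u k n).1) +
  'i ^+ 2 * s ^+ 2 * k * (exp_coefs u k n).2.
  by ring.
by rewrite sqr_i; ring.
Qed.

(** The evaluations of [V] at [i s] and [- i s] determine both coefficients
    when [s != 0].  Otherwise [u = 1], since -1 is on the cut, and the series is
    [1 + V]. *)
Lemma exp_coefs_cvg u : off_cut u ->
  let p := exp_coefs u (arccos_ratio u) in
  ccvg \oo (fun N => \sum_(n < N) (p n).1 / n`!%:R) u /\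
  ccvg \oo (fun N => \sum_(n < N) (p n).2 / n`!%:R) 1.
Proof.
move=> uc p; pose s := sqrtc (1 - u ^+ 2).
have s2 : s ^+ 2 = 1 - u ^+ 2 by rewrite sqr_sqrtc.
have i0 : 'i != 0 :> C by rewrite -(sqrf_eq0 'i) sqr_i oppr_eq0 oner_eq0.
have [s0|s0] := eqVneq s 0.
  have u1 : u = 1.
    move: s2; rewrite s0 expr0n/= => /esym/eqP.
    rewrite subr_eq0 eq_sym sqrf_eq1.
    case/orP => /eqP // uN1; have := off_cut_1D uc.
    by rewrite uN1 subrr eqxx.
  have pE n : p n.+2 = (0, 0).
    by rewrite /p u1 /= expr1n subrr mulr0 !mul0r oppr0 mulr0.
  have pS N : \sum_(n < N.+2) (p n).1 / n`!%:R = u /\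
      \sum_(n < N.+2) (p n).2 / n`!%:R = 1.
    rewrite !big_ord_recl !big1 => [|n _|n _]; try by rewrite !lift0 pE mul0r.
    rewrite /p /= u1 arccos_ratio1 expr1n subrr.
    by rewrite !(mulr0,mul0r,oppr0,addr0,add0r,mulr1,divr1).
  split; apply: ccvg_near (ccvg_cst _); exists 2%N => // -[|[|N]] //= _;
    by have [] := pS N.
have is0 : 'i * s != 0 by rewrite mulf_neq0.
have ep := exp_sum_arccos_ratio uc s2.
have Ns2 : (- s) ^+ 2 = 1 - u ^+ 2 by rewrite sqrrN.
have em := exp_sum_arccos_ratio uc Ns2; rewrite mulrN mulNr !opprK in em.
have pw n : (p n).1 + 'i * s * (p n).2 = ('i * s * arccos_ratio u) ^+ n.
  exact: exp_coefs_pow.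
have pwN n : (p n).1 - 'i * s * (p n).2 = (- ('i * s * arccos_ratio u)) ^+ n.
  by have := exp_coefs_pow (arccos_ratio u) n Ns2; rewrite mulrN !mulNr.
have fact0 (n : nat) : n`!%:R != 0 :> C by rewrite pnatr_eq0 -lt0n fact_gt0.
split.
  have -> : u = ((u + 'i * s) + (u - 'i * s)) * 2^-1 by field.
  apply: ccvg_eq (ccvgM (ccvgD em ep) (ccvg_cst 2^-1)) => // N.
  rewrite /exp_sum -big_split/= big_distrl/=; apply: eq_bigr => n _.
  by rewrite -pw -pwN -mulrDl; field.
apply: (ccvg_eq _ _ (ccvgM (ccvgB em ep) (ccvg_cst (2 * ('i * s))^-1))) => [N|];
  last first.
  by field; rewrite i0 s0.
rewrite /exp_sum -sumrB big_distrl/=; apply: eq_bigr => n _.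
by rewrite -pw -pwN -mulrBl; field; rewrite fact0 i0 s0.
Qed.

End exponential.

(** * Holomorphic functions of a point of the plane *)

Section holomorphic.
Context {R : realType}.
Local Notation C := R[i].
Implicit Types (z w : R * R) (D : set (R * R)) (g : R * R -> C).

(** The points of the segment between [a] and [b] are described by their
    distance to [a], whatever the order of [a] and [b]. *)
Lemma mean_value_dist (f df : R -> R) (a b M : R) :
  (forall t : R, `|t - a| <= `|b - a| -> is_derive t 1 f (df t)) ->
  (forall t : R, `|t - a| <= `|b - a| -> `|df t| <= M) ->
  `|f b - f a| <= M * `|b - a|.
Proof.
move=> fd fM.
have segP (c d t : R) : c <= d -> (c = a /\ d = b) \/ (c = b /\ d = a) ->
    t \in `[c, d] -> `|t - a| <= `|b - a|.
  rewrite in_itv/= => cd ab /andP[ct td].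
  case: ab => -[ca db]; subst c d; last first.
    by rewrite distrC [leRHS]distrC !ger0_norm ?subr_ge0//; lra.
  by rewrite !ger0_norm ?subr_ge0//; lra.
have mv (c d : R) : c <= d -> (c = a /\ d = b) \/ (c = b /\ d = a) ->
    `|f d - f c| <= M * `|d - c|.
  move=> cd ab.
  have fd' (t : R) : t \in `]c, d[ -> is_derive t 1 f (df t).
    by move=> /subset_itv_oo_cc tcd; apply: fd; exact: segP tcd.
  have fc : {within `[c, d], continuous f}.
    apply: derivable_within_continuous => t tcd.
    by have [] := fd _ (segP _ _ _ cd ab tcd).
  have [t tcd ->] := @MVT_segment R f df c d cd fd' fc.
  by rewrite normrM ler_wpM2r// fM//; exact: segP tcd.
case: (leP a b) => [ab|/ltW ba]; first by apply: mv => //; left.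
by rewrite distrC [`|b - a|]distrC; apply: mv => //; right.
Qed.

Lemma is_derive_fst (f : R * R -> R) (s y d : R) :
  is_derive (s, y) ((1, 0) : R * R) f d -> is_derive s 1 (fun s => f (s, y)) d.
Proof.
case=> fd <-.
have quotientE : (fun h => h^-1 *:
    ((f \o shift (s, y)) (h *: ((1, 0) : R * R)) - f (s, y))) =
  (fun h => h^-1 *: (((fun s => f (s, y)) \o shift s) (h *: 1) - f (s, y))).
  apply/funext => h; congr (_ *: (f _ - _)).
  by rewrite /= /shift /=; congr pair; rewrite /= scaler0 add0r.
by split; rewrite /derivable /derive -quotientE.
Qed.

Lemma is_derive_snd (f : R * R -> R) (x s d : R) :
  is_derive (x, s) ((0, 1) : R * R) f d -> is_derive s 1 (fun s => f (x, s)) d.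
Proof.
case=> fd <-.
have quotientE : (fun h => h^-1 *:
    ((f \o shift (x, s)) (h *: ((0, 1) : R * R)) - f (x, s))) =
  (fun h => h^-1 *: (((fun s => f (x, s)) \o shift s) (h *: 1) - f (x, s))).
  apply/funext => h; congr (_ *: (f _ - _)).
  by rewrite /= /shift /=; congr pair; rewrite /= scaler0 add0r.
by split; rewrite /derivable /derive -quotientE.
Qed.

(** Bounded partial derivatives near [z] make [f] Lipschitz near [z], by the
    mean value theorem along the two sides of a right angle. *)
Lemma continuous_partials (f f1 f2 : R * R -> R) z :
  (\forall w \near z, is_derive w ((1, 0) : R * R) f (f1 w) /\
                      is_derive w ((0, 1) : R * R) f (f2 w)) ->
  {for z, continuous f1} -> {for z, continuous f2} -> {for z, continuous f}.
Proof.
move=> fd c1 c2; pose M := `|f1 z| + `|f2 z| + 1.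
have bnd (k : R * R -> R) : {for z, continuous k} -> `|k z| < M ->
    \forall w \near z, `|k w| < M.
  move=> kc kM; have : (fun w => `|k w|) @ z --> `|k z| by exact: cvg_norm.
  by move/cvgr_lt; apply.
have M1 : `|f1 z| < M.
  by rewrite /M; have := normr_ge0 (f2 z); lra.
have M2 : `|f2 z| < M.
  by rewrite /M; have := normr_ge0 (f1 z); lra.
have : \forall w \near z, (is_derive w ((1, 0) : R * R) f (f1 w) /\
    is_derive w ((0, 1) : R * R) f (f2 w)) /\ (`|f1 w| < M /\ `|f2 w| < M).
  by apply: filterI => //; apply: filterI; apply: bnd.
move=> /nbhs_ballP[e /= e0 zP].
have fz w : ball z e w -> `|f w - f z| <= M * `|w.1 - z.1| + M * `|w.2 - z.2|.
  case: w z {c1 c2 fd bnd M1 M2} @M zP => [w1 w2] [z1 z2] M zP [/= b1 b2].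
  have -> : f (w1, w2) - f (z1, z2) =
      (f (w1, w2) - f (z1, w2)) + (f (z1, w2) - f (z1, z2)).
    by rewrite addrA subrK.
  rewrite (le_trans (ler_normD _ _))// lerD//.
    apply: (@mean_value_dist (fun s => f (s, w2))
      (fun s => f1 (s, w2))) => s sz.
      apply: is_derive_fst; apply: (zP (s, w2) _).1.1; split => //=.
      by rewrite /ball/= distrC (le_lt_trans sz)// distrC.
    apply/ltW; apply: (zP (s, w2) _).2.1; split => //=.
    by rewrite /ball/= distrC (le_lt_trans sz)// distrC.
  apply: (@mean_value_dist (fun s => f (z1, s)) (fun s => f2 (z1, s))) => s sz.
    apply: is_derive_snd; apply: (zP (z1, s) _).1.2.
    split => //=; first exact: ballxx.
    by rewrite /ball/= distrC (le_lt_trans sz)// distrC.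
  apply/ltW; apply: (zP (z1, s) _).2.2; split => //=; first exact: ballxx.
  by rewrite /ball/= distrC (le_lt_trans sz)// distrC.
apply/subr_cvg0; apply/norm_cvg0P.
apply: (@squeeze_cvgr _ _ _ _ (fun=> 0)
  (fun w => M * `|w.1 - z.1| + M * `|w.2 - z.2|)).
- apply: filterS (nbhsx_ballx z e e0) => w zw; rewrite normr_ge0/=; exact: fz.
- exact: cvg_cst.
- rewrite -[X in _ --> X](addr0 0) -[X in _ --> X + X](mulr0 M).
  have c1' : (fun w => w.1 - z.1) @ z --> 0.
    by rewrite -(subrr z.1); apply: cvgB; [exact: cvg_fst|exact: cvg_cst].
  have c2' : (fun w => w.2 - z.2) @ z --> 0.
    by rewrite -(subrr z.2); apply: cvgB; [exact: cvg_snd|exact: cvg_cst].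
  by apply: cvgD; apply: cvgMr; exact/norm_cvg0P.
Qed.

(** The two partial derivatives are [g'] and [i g'], which is the
    Cauchy-Riemann system; the continuity of [g'] makes [g] of class C1. *)
Definition holomorphic D g := exists g', forall z, D z ->
  [/\ cderive g z ((1, 0) : R * R) (g' z),
      cderive g z ((0, 1) : R * R) ('i * g' z) &
      ccvg (nbhs z) g' (g' z)].

Lemma holomorphic_sub D E g : E `<=` D -> holomorphic D g -> holomorphic E g.
Proof. by move=> ED [g' gD]; exists g' => z /ED; exact: gD. Qed.

Lemma holomorphic_cvg D g z : open D -> holomorphic D g -> D z ->
  ccvg (nbhs z) g (g z).
Proof.
move=> oD [g' gD] Dz; have [_ _ [c1 c2]] := gD _ Dz.
have nD : \forall w \near z, D w by exact: open_nbhs_nbhs.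
have [ic1 ic2] : ccvg (nbhs z) (fun w => 'i * g' w) ('i * g' z).
  by apply: ccvgM; [exact: ccvg_cst|split].
split.
  apply: (continuous_partials (f1 := fun w => Re (g' w))
    (f2 := fun w => Re ('i * g' w))) => //.
  apply: filterS nD => w /gD[/cderiveP[? _] /cderiveP[? _] _]; by split.
apply: (continuous_partials (f1 := fun w => Im (g' w))
  (f2 := fun w => Im ('i * g' w))) => //.
by apply: filterS nD => w /gD[/cderiveP[_ ?] /cderiveP[_ ?] _]; split.
Qed.

Lemma holomorphic_cst D (k : C) : holomorphic D (fun=> k).
Proof.
exists (fun=> 0) => z _; rewrite mulr0.
by split; [exact: cderive_cst|exact: cderive_cst|exact: ccvg_cst].
Qed.

Lemma holomorphicM D g h : open D -> holomorphic D g -> holomorphic D h ->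
  holomorphic D (fun z => g z * h z).
Proof.
move=> oD gD hD.
have gc := holomorphic_cvg oD gD; have hc := holomorphic_cvg oD hD.
case: gD hD => [g' gD] [h' hD].
exists (fun z => g' z * h z + g z * h' z) => z Dz.
have [g1 g2 g3] := gD _ Dz; have [h1 h2 h3] := hD _ Dz.
split; first exact: cderiveM.
- by apply: cderive_eq (cderiveM g2 h2) => //; ring.
- by apply: ccvgD; apply: ccvgM => //; [exact: hc|exact: gc].
Qed.

Lemma holomorphic_arccos_ratio D g : open D -> holomorphic D g ->
  (forall z, D z -> off_cut (g z)) ->
  holomorphic D (fun z => arccos_ratio (g z)).
Proof.
move=> oD gD gcut; have gc := holomorphic_cvg oD gD.
case: gD => [g' gD]; exists (fun z => g' z * - slope (g z) (g z)) => z Dz.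
have [g1 g2 g3] := gD _ Dz; have zcut := gcut _ Dz.
have ccvgN (T : Type) (F : set_system T) (f : T -> C) l : Filter F ->
    ccvg F f l -> ccvg F (fun x => - f x) (- l).
  move=> FF fl; apply: ccvg_eq (ccvgM (ccvg_cst (-1)) fl) => [x|];
    exact: mulN1r.
have chain (v : R * R) d : cderive g z v d ->
    cderive (fun z => arccos_ratio (g z)) z v (d * - slope (g z) (g z)).
  move=> gd; have gl := cderive_cvg gd.
  apply: (cderive_slope (s := fun h => - slope (g (h *: v + z)) (g z)) gd).
    apply: filterS (pole_free_cvg _ zcut gl) => h gh.
    by rewrite arccos_ratioB//; exact: off_cut_pole_free.
  by apply: ccvgN; apply: slope_cvg => //; exact: ccvg_cst.
split; first exact: chain.
- by rewrite mulrA; exact: chain.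
- apply: ccvgM => //; apply: ccvgN; apply: slope_cvg => //; exact: gc.
Qed.

Lemma open_off_cut D g : open D -> holomorphic D g ->
  open (D `&` [set z | off_cut (g z)]).
Proof.
move=> oD gD; rewrite openE => z [Dz zcut].
have [g1 g2] := holomorphic_cvg oD gD Dz.
apply: filterI; first exact: open_nbhs_nbhs.
have [z0|z0] := eqVneq (Im (g z)) 0; last first.
  have : \forall w \near z, Im (g w) != 0 by exact: cvgr_neq0 g2 z0.
  by apply: filterS => w /eqP w0 [].
have z1 : -1 < Re (g z) by rewrite ltNge; apply/negP => z1; apply: zcut.
have : \forall w \near z, -1 < Re (g w) by move/cvgr_gt : g1; exact.
by apply: filterS => w w1 [_]; rewrite leNgt w1.
Qed.

End holomorphic.

(** * Coordinates of quaternions and of stem functions *)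

Section quaternion_coordinates.
Context {R : realType}.
Local Notation C := R[i].
Local Notation H := (quat R).
Implicit Types (p q : H) (n : nat).

Definition qcoord n q : R :=
  match n with
  | 0%N => coord0 q | 1%N => coord1 q | 2%N => coord2 q | _ => coord3 q
  end.

Definition quat_of_coord (x : nat -> R) : H :=
  Quat (x 0%N) (x 1%N) (x 2%N) (x 3%N).

Lemma qcoordK (x : nat -> R) n : (n < 4)%N -> qcoord n (quat_of_coord x) = x n.
Proof. by case: n => [|[|[|[|n]]]]. Qed.

Lemma qcoordD n p q : qcoord n (p + q) = qcoord n p + qcoord n q.
Proof. by case: n => [|[|[|n]]]. Qed.

Lemma qcoordN n p : qcoord n (- p) = - qcoord n p.
Proof. by case: n => [|[|[|n]]]. Qed.

Lemma qcoordZ n (a : R) p : qcoord n (a *: p) = a * qcoord n p.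
Proof. by case: n => [|[|[|n]]]. Qed.

Lemma quat_normE q : `|q| = qnorm q.
Proof. by []. Qed.

Lemma normr_qcoord_le n q : `|qcoord n q| <= `|q|.
Proof.
rewrite quat_normE /qnorm -sqrtr_sqr ler_wsqrtr// /qnormsq.
have := sqr_ge0 (coord0 q); have := sqr_ge0 (coord1 q).
have := sqr_ge0 (coord2 q); have := sqr_ge0 (coord3 q).
by case: n => [|[|[|n]]] /=; lra.
Qed.

Lemma norm_quat_le q :
  `|q| <= `|coord0 q| + `|coord1 q| + `|coord2 q| + `|coord3 q|.
Proof.
have normE (a : R) (e : H) : qnormsq e = 1 -> `|a *: e| = `|a|.
  by move=> e1; rewrite normrZ quat_normE /qnorm e1 sqrtr1 mulr1.
have {1}-> : q = coord0 q *: Quat 1 0 0 0 + coord1 q *: quat_i R +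
    coord2 q *: quat_j R + coord3 q *: quat_k R.
  by case: q => a b c d; apply: quat_eq => /=; ring.
rewrite (le_trans (ler_normD _ _))// lerD//; last first.
  by rewrite normE// /qnormsq /=; ring.
rewrite (le_trans (ler_normD _ _))// lerD//; last first.
  by rewrite normE// /qnormsq /=; ring.
by rewrite (le_trans (ler_normD _ _))// lerD// normE// /qnormsq /=; ring.
Qed.

Lemma cvg_qcoord (T : Type) (F : set_system T) {FF : Filter F} (f : T -> H)
    (l : H) n :
  f @ F --> l -> (fun x => qcoord n (f x)) @ F --> qcoord n l.
Proof.
move=> fl; have /norm_cvg0P f0 : (fun x => f x - l) @ F --> 0.
  by rewrite -(subrr l); apply: cvgB => //; exact: cvg_cst.
apply/subr_cvg0; apply/norm_cvg0P.
apply: (@squeeze_cvgr _ _ _ _ (fun=> 0) (fun x => `|f x - l|)) => //.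
  by apply: nearW => x; rewrite normr_ge0/= -qcoordN -qcoordD normr_qcoord_le.
exact: cvg_cst.
Qed.

Lemma cvg_quat (T : Type) (F : set_system T) {FF : Filter F} (f : T -> H)
    (l : H) :
  (forall n, (n < 4)%N -> (fun x => qcoord n (f x)) @ F --> qcoord n l) ->
  f @ F --> l.
Proof.
move=> fl.
have f0 n : (n < 4)%N -> (fun x => `|qcoord n (f x - l)|) @ F --> (0 : R).
  move=> n4; apply/norm_cvg0P; under eq_fun do rewrite qcoordD qcoordN.
  by rewrite -(subrr (qcoord n l)); apply: cvgB; [exact: fl|exact: cvg_cst].
apply/subr_cvg0; apply/norm_cvg0P.
apply: (@squeeze_cvgr _ _ _ _ (fun=> 0) (fun x => `|coord0 (f x - l)| +
  `|coord1 (f x - l)| + `|coord2 (f x - l)| + `|coord3 (f x - l)|)).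
- by apply: nearW => x; rewrite normr_ge0/= norm_quat_le.
- exact: cvg_cst.
rewrite -[X in _ --> X]addr0 -[X in _ --> X + _]addr0.
rewrite -[X in _ --> X + _ + _]addr0.
apply: cvgD; last exact: (f0 3%N).
apply: cvgD; last exact: (f0 2%N).
by apply: cvgD; [exact: (f0 0%N)|exact: (f0 1%N)].
Qed.

Lemma is_derive_quatP (V : normedModType R) (f : V -> H) (x v : V) (d : H) :
  is_derive x v f d <->
  (forall n, (n < 4)%N -> is_derive x v (fun y => qcoord n (f y)) (qcoord n d)).
Proof.
have quotientE n :
    (fun h : R => qcoord n (h^-1 *: ((f \o shift x) (h *: v) - f x))) =
    (fun h => h^-1 *: (((fun y => qcoord n (f y)) \o shift x) (h *: v) -
                       qcoord n (f x))).
  by apply/funext => h; rewrite qcoordZ qcoordD qcoordN.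
split=> [[fd <-] n _|fd].
  have fnd :
      (fun h : R => qcoord n (h^-1 *: ((f \o shift x) (h *: v) - f x))) @ 0^'
      --> qcoord n ('D_v f x) by exact: cvg_qcoord.
  rewrite quotientE in fnd.
  by split; [exact: cvgP fnd|exact: cvg_lim fnd].
have : (fun h : R => h^-1 *: ((f \o shift x) (h *: v) - f x)) @ 0^' --> d.
  by apply: cvg_quat => n n4; rewrite quotientE; have [fnd <-] := fd n n4.
by move=> f'd; split; [exact: cvgP f'd|exact: cvg_lim f'd].
Qed.

End quaternion_coordinates.

Section stem_coordinates.
Context {R : realType}.
Local Notation C := R[i].
Local Notation H := (quat R).
Implicit Types (D E : set (R * R)) (F : R * R -> H) (z : R * R).

(** A stem function takes values in the complexified quaternions, which are
    described by four complex coordinates. *)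
Definition stem_coord n F0 F1 z : C := qcoord n (F0 z) +i* qcoord n (F1 z).

(** The Cauchy-Riemann system of a stem function splits into those of its four
    complex coordinates. *)
Lemma holomorphic_stem_coord D F0 F1 n : (n < 4)%N ->
  holomorphic_stem D F0 F1 -> holomorphic D (stem_coord n F0 F1).
Proof.
move=> n4 [C0 C1 _ CR].
exists (fun z => qcoord n (d_alpha F0 z) +i* qcoord n (d_alpha F1 z)) => z Dz.
have [/derivableP a0 /derivableP b0 ca0 _] := C0 _ Dz.
have [/derivableP a1 /derivableP b1 ca1 _] := C1 _ Dz.
have [CR1 CR2] := CR _ Dz.
have coordP := fun x v f d => proj1 (is_derive_quatP f x v d).
split.
- by apply/cderiveP; split; [exact: coordP a0 _ n4|exact: coordP a1 _ n4].
- apply/cderiveP; split.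
    have -> : Re ('i * (qcoord n (d_alpha F0 z) +i* qcoord n (d_alpha F1 z))) =
        qcoord n (d_beta F0 z).
      by rewrite CR2 qcoordN reM /= mul0r sub0r mul1r.
    exact: coordP b0 _ n4.
  have -> : Im ('i * (qcoord n (d_alpha F0 z) +i* qcoord n (d_alpha F1 z))) =
      qcoord n (d_beta F1 z).
    by rewrite CR1 imM /= mul0r add0r mul1r.
  exact: coordP b1 _ n4.
- by split; exact: cvg_qcoord.
Qed.

Lemma holomorphic_stem_of_coord D F0 F1 : open D ->
  (forall n, (n < 4)%N -> holomorphic D (stem_coord n F0 F1)) ->
  (forall z, D z -> F0 (conjz z) = F0 z /\ F1 (conjz z) = - F1 z) ->
  holomorphic_stem D F0 F1.
Proof.
move=> oD holoF sym.
have /choice[G' GD] : forall n, exists g', (n < 4)%N -> forall z, D z ->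
    [/\ cderive (stem_coord n F0 F1) z ((1, 0) : R * R) (g' z),
        cderive (stem_coord n F0 F1) z ((0, 1) : R * R) ('i * g' z) &
        ccvg (nbhs z) g' (g' z)].
  move=> n; case: (ltnP n 4) => n4; last by exists (fun=> 0).
  by have [g' gD] := holoF n n4; exists g'.
pose A0 z := quat_of_coord (fun n => Re (G' n z)).
pose A1 z := quat_of_coord (fun n => Im (G' n z)).
have dF0 z : D z -> is_derive z ((1, 0) : R * R) F0 (A0 z).
  move=> Dz; apply/is_derive_quatP => n n4; rewrite qcoordK//.
  by have [/cderiveP[]] := GD n n4 z Dz.
have dF1 z : D z -> is_derive z ((1, 0) : R * R) F1 (A1 z).
  move=> Dz; apply/is_derive_quatP => n n4; rewrite qcoordK//.
  by have [/cderiveP[]] := GD n n4 z Dz.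
have eF0 z : D z -> is_derive z ((0, 1) : R * R) F0 (- A1 z).
  move=> Dz; apply/is_derive_quatP => n n4; rewrite qcoordN qcoordK//.
  have [_ /cderiveP[+ _] _] := GD n n4 z Dz.
  by rewrite reM /= mul0r sub0r mul1r.
have eF1 z : D z -> is_derive z ((0, 1) : R * R) F1 (A0 z).
  move=> Dz; apply/is_derive_quatP => n n4; rewrite qcoordK//.
  have [_ /cderiveP[_ +] _] := GD n n4 z Dz.
  by rewrite imM /= mul0r add0r mul1r.
have cA0 z : D z -> {for z, continuous A0}.
  move=> Dz; apply: cvg_quat => n n4; rewrite qcoordK//.
  under eq_fun do rewrite qcoordK//.
  by have [_ _ []] := GD n n4 z Dz.
have cA1 z : D z -> {for z, continuous A1}.
  move=> Dz; apply: cvg_quat => n n4; rewrite qcoordK//.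
  under eq_fun do rewrite qcoordK//.
  by have [_ _ []] := GD n n4 z Dz.
have near_cont (f g : R * R -> H) z : D z -> (forall w, D w -> f w = g w) ->
    {for z, continuous g} -> {for z, continuous f}.
  move=> Dz fg gc; rewrite /prop_for /continuous_at fg//.
  apply: cvg_trans gc; apply: near_eq_cvg.
  have : \forall w \near z, D w by exact: open_nbhs_nbhs.
  by apply: filterS => w /fg ->.
split => //.
- move=> z Dz; have [da _] := dF0 z Dz; have [db _] := eF0 z Dz.
  split; [exact: da|exact: db| |].
    by apply: near_cont Dz _ (cA0 z Dz) => w /dF0[].
  apply: (near_cont _ (fun z => - A1 z)) => // [w /eF0[]//|].
  by apply: cvgN; exact: cA1.
- move=> z Dz; have [da _] := dF1 z Dz; have [db _] := eF1 z Dz.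
  split; [exact: da|exact: db| |].
    by apply: near_cont Dz _ (cA1 z Dz) => w /dF1[].
  by apply: near_cont Dz _ (cA0 z Dz) => w /eF1[].
- move=> z Dz; rewrite /d_alpha /d_beta.
  have [_ ->] := dF0 z Dz; have [_ ->] := dF1 z Dz.
  by have [_ ->] := eF0 z Dz; have [_ ->] := eF1 z Dz.
Qed.

Lemma holomorphic_stem_sub D E F0 F1 : E `<=` D ->
  holomorphic_stem D F0 F1 -> holomorphic_stem E F0 F1.
Proof.
move=> ED [C0 C1 sym CR].
by split=> z /ED; [exact: C0|exact: C1|exact: sym|exact: CR].
Qed.

Lemma stem_coord_conjz n F0 F1 z :
  F0 (conjz z) = F0 z -> F1 (conjz z) = - F1 z ->
  stem_coord n F0 F1 (conjz z) = (stem_coord n F0 F1 z)^*.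
Proof. by move=> e0 e1; rewrite /stem_coord e0 e1 qcoordN. Qed.

End stem_coordinates.

(** * Imaginary units and slices *)

Section slices.
Context {R : realType}.
Local Notation C := R[i].
Local Notation H := (quat R).
Implicit Types (I J p q X Y : H) (z : R * R) (O : set H).

Lemma imag_unitP I : imag_units I <->
  coord0 I = 0 /\ coord1 I ^+ 2 + coord2 I ^+ 2 + coord3 I ^+ 2 = 1.
Proof.
case: I => a b c d; rewrite /imag_units /= expr2.
split=> [[]|[-> n1]]; last first.
  by apply: quat_eq => /=; [lra|ring|ring|ring].
move=> h0 h1 h2 h3.
have ab : a * b = 0 by lra.
have ac : a * c = 0 by lra.
have ad : a * d = 0 by lra.
have a0 : a = 0.
  apply/eqP; apply: contraT => a0.
  have : a * a = -1.
    move: ab ac ad => /eqP; rewrite mulf_eq0 (negPf a0)/= => /eqP b0.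
    move=> /eqP; rewrite mulf_eq0 (negPf a0)/= => /eqP c0.
    move=> /eqP; rewrite mulf_eq0 (negPf a0)/= => /eqP d0.
    by move: h0; rewrite b0 c0 d0 !mulr0 !subr0.
  by move=> aa; have := sqr_ge0 a; rewrite expr2 aa oppr_ge0 ler10.
by split => //; move: h0; rewrite a0; lra.
Qed.

Lemma imag_unit_sqr I : imag_units I -> I * I = -1.
Proof. by rewrite /imag_units /= expr2. Qed.

Lemma imag_unitN I : imag_units I -> imag_units (- I).
Proof. by rewrite /imag_units /= sqrrN. Qed.

Lemma imag_unit_i : imag_units (quat_i R).
Proof. by apply/imag_unitP; split=> //=; ring. Qed.

Lemma imag_unit_j : imag_units (quat_j R).
Proof. by apply/imag_unitP; split=> //=; ring. Qed.

Lemma quat_unit p : p != 0 -> p \is a GRing.unit.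
Proof. by []. Qed.

Lemma imag_unit_conj I p : p != 0 -> imag_units I -> imag_units (p^-1 * I * p).
Proof.
move=> p0 /imag_unit_sqr I2; rewrite /imag_units /= expr2.
rewrite !mulrA (mulrK (quat_unit p0)).
by rewrite -[_ * I * I]mulrA I2 mulrN1 mulNr mulVr ?quat_unit.
Qed.

Lemma imag_unitZ_norm I (a : R) : imag_units I -> `|a *: I| = `|a|.
Proof.
move=> /imag_unitP[I0 I1]; rewrite normrZ quat_normE /qnorm /qnormsq I0.
by rewrite expr0n add0r I1 sqrtr1 mulr1.
Qed.

Lemma coord0_quat_of z I : imag_units I -> coord0 (quat_of z I) = z.1.
Proof.
by move=> /imag_unitP[I0 _]; rewrite /quat_of /= I0 mulr0 addr0 mulr1.
Qed.

Lemma qvec_quat_of z I : imag_units I -> qvec (quat_of z I) = z.2 *: I.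
Proof.
move=> I1; rewrite /qvec coord0_quat_of// /quat_of.
by rewrite addrC addrA addNr add0r.
Qed.

Lemma sphere_quat_of z I J : imag_units I -> imag_units J ->
  sphere (quat_of z I) (quat_of z J).
Proof.
move=> I1 J1; rewrite /sphere qvec_quat_of// imag_unitZ_norm// coord0_quat_of//.
case: (leP 0 z.2) => z2.
  by exists J => //; rewrite ger0_norm.
exists (- J); first exact: imag_unitN.
by rewrite ltr0_norm// /quat_of /= scaleNr scalerN opprK.
Qed.

Lemma circular_quat_of O z I J : circular O -> imag_units I -> imag_units J ->
  O (quat_of z I) -> O (quat_of z J).
Proof. by move=> cO I1 J1 /cO; apply; exact: sphere_quat_of. Qed.

Lemma stem_dom_quat_of O z I : circular O -> imag_units I -> stem_dom O z ->
  O (quat_of z I).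
Proof. by move=> cO I1 [J J1]; exact: circular_quat_of. Qed.

Lemma open_stem_dom O : open O -> open (stem_dom O).
Proof.
move=> oO; rewrite openE => z [I I1 zO].
have qc : quat_of w I @[w --> z] --> quat_of z I.
  apply: cvgD.
    by apply: cvgZ; [exact: cvg_fst|exact: cvg_cst].
  by apply: cvgZ; [exact: cvg_snd|exact: cvg_cst].
have : nbhs (quat_of z I) O by exact: open_nbhs_nbhs.
move=> /qc zO'; have sub : (fun w => O (quat_of w I)) `<=` stem_dom O.
  by move=> w wO; exists I.
exact: filterS sub zO'.
Qed.

(** The polar decomposition [q = alpha + I beta] with [0 <= beta]; the unit is
    arbitrary on the real axis. *)
Definition slice_point q : R * R := (coord0 q, `|qvec q|).

Definition slice_unit q : H :=
  if qvec q == 0 then quat_i R else `|qvec q|^-1 *: qvec q.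

Lemma imag_slice_unit q : imag_units (slice_unit q).
Proof.
rewrite /slice_unit; case: eqVneq => [_|q0]; first exact: imag_unit_i.
apply/imag_unitP; set a := `|_|^-1.
have qv0 : coord0 (qvec q) = 0 by rewrite /qvec /= mulr1 subrr.
split; first by rewrite -[LHS]/(a * coord0 (qvec q)) qv0 mulr0.
have -> : coord1 (a *: qvec q) ^+ 2 + coord2 (a *: qvec q) ^+ 2 +
    coord3 (a *: qvec q) ^+ 2 = a ^+ 2 * qnormsq (qvec q).
  by rewrite /qnormsq qv0; move: (qvec q) => p /=; ring.
rewrite /a quat_normE /qnorm exprVn sqr_sqrtr ?qnormsq_ge0// mulVf//.
by rewrite qnormsq_eq0.
Qed.

Lemma quat_of_slice q : quat_of (slice_point q) (slice_unit q) = q.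
Proof.
rewrite /quat_of /= /slice_unit; case: eqVneq => [q0|q0].
  by rewrite q0 normr0 scale0r addr0; move/eqP: q0; rewrite subr_eq0 => /eqP.
rewrite scalerA divff ?scale1r ?normr_eq0//.
by rewrite addrC /qvec subrK.
Qed.

Definition slice_extension (F0 F1 : R * R -> H) q : H :=
  F0 (slice_point q) + slice_unit q * F1 (slice_point q).

(** Each non-real point has two descriptions, by [I] and [- I], which agree by
    the parity of [F0] and [F1]; on the real axis [F1] vanishes, so the value
    does not depend on [I]. *)
Lemma slice_extensionE (F0 F1 : R * R -> H) z I : imag_units I ->
  F0 (conjz z) = F0 z -> F1 (conjz z) = - F1 z ->
  slice_extension F0 F1 (quat_of z I) = F0 z + I * F1 z.
Proof.
move=> I1 e0 e1; rewrite /slice_extension /slice_point /slice_unit.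
rewrite qvec_quat_of// imag_unitZ_norm// coord0_quat_of//.
have I0 : I != 0.
  apply/eqP => I0; move: (imag_unit_sqr I1); rewrite I0 mul0r => /esym/eqP.
  by rewrite oppr_eq0 oner_eq0.
case: z e0 e1 => a b /= e0 e1; rewrite scaler_eq0 (negPf I0) orbF.
case: (ltrgtP b 0) => b0.
- rewrite ltr0_norm// -[(a, - b)]/(conjz (a, b)) e0 e1 scalerA.
  have -> : (- b)^-1 * b = -1 by rewrite invrN mulNr mulVf// lt_eqF.
  by rewrite scaleN1r mulrNN.
- by rewrite gtr0_norm// scalerA mulVf ?gt_eqF// scale1r.
- rewrite b0 normr0; move: e1; rewrite /conjz b0 /= oppr0 => e1.
  have -> : F1 (a, 0) = 0.
    have : F1 (a, 0) *+ 2 = 0 by rewrite mulr2n {1}e1 addNr.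
    rewrite -scaler_nat => /eqP; rewrite scaler_eq0 pnatr_eq0/=.
    by move/eqP.
  by rewrite !mulr0.
Qed.

(** Comparing the values at [I] and [- I] separates the two components. *)
Lemma induced_inj X Y X' Y' :
  (forall I, imag_units I -> X + I * Y = X' + I * Y') -> X = X' /\ Y = Y'.
Proof.
move=> XY.
have h1 := XY _ imag_unit_i; have h2 := XY _ (imag_unitN imag_unit_i).
have X2 : X *+ 2 = X' *+ 2.
  have : (X + quat_i R * Y) + (X + - quat_i R * Y) =
         (X' + quat_i R * Y') + (X' + - quat_i R * Y') by rewrite h1 h2.
  by rewrite !mulNr addrACA [in RHS]addrACA !subrr !addr0 !mulr2n.
have XX : X = X'.
  have : (2 : R) *: X = 2 *: X' by rewrite !scaler_nat.
  move=> /(congr1 (fun x => (2 : R)^-1 *: x)).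
  by rewrite !scalerA mulVf ?pnatr_eq0// !scale1r.
split => //; move: h1; rewrite XX => /addrI /(congr1 (fun x => - quat_i R * x)).
by rewrite !mulrA !mulNr (imag_unit_sqr imag_unit_i) !mulN1r !opprK.
Qed.

(** At the point of unit [I] of a sphere, the slice product is the product in
    the complexified quaternions, whether or not [f] vanishes there. *)
Lemma star_induced (f p : H -> H) z I X Y : imag_units I ->
  (forall J, imag_units J -> p (quat_of z J) = X + J * Y) ->
  star f p (quat_of z I) = f (quat_of z I) * X + I * (f (quat_of z I) * Y).
Proof.
move=> I1 pXY; rewrite /star; case: eqVneq => [->|f0].
  by rewrite !mul0r mulr0 addr0.
move: (f (quat_of z I)) f0 => a a0.
have Ia := imag_unit_conj a0 I1.
move: a^-1 (mulVr (quat_unit a0)) (mulrV (quat_unit a0)) Ia => b ba ab Ia.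
have -> : b * quat_of z I * a = quat_of z (b * I * a).
  by rewrite /quat_of mulrDr mulrDl -!scalerAr -!scalerAl mulr1 ba.
by rewrite pXY// mulrDr !mulrA ab mul1r.
Qed.

End slices.

(** * Real part and symmetrization in terms of stem functions *)

Section stem_of_slice_functions.
Context {R : realType}.
Local Notation C := R[i].
Local Notation H := (quat R).
Implicit Types (I J p q X Y : H) (z : R * R) (O : set H) (f g : H -> H).

Lemma stem_of_unique O F0 F1 G0 G1 g z : circular O -> stem_dom O z ->
  induces O F0 F1 g -> induces O G0 G1 g -> F0 z = G0 z /\ F1 z = G1 z.
Proof.
move=> cO Oz Fg Gg; apply: induced_inj => I I1.
by rewrite -(Fg I z) -?(Gg I z)//; exact: stem_dom_quat_of.
Qed.

Lemma slice_extension_induces O F0 F1 :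
  (forall z, stem_dom O z -> F0 (conjz z) = F0 z /\ F1 (conjz z) = - F1 z) ->
  induces O F0 F1 (slice_extension F0 F1).
Proof.
move=> sym I z I1 zO.
have [e0 e1] : F0 (conjz z) = F0 z /\ F1 (conjz z) = - F1 z.
  by apply: sym; exists I.
exact: slice_extensionE.
Qed.

(** The slices of [i] and [j] meet in the real axis. *)
Lemma cplane_common X : (forall I, imag_units I -> cplane I X) ->
  X = (coord0 X)%:A.
Proof.
move=> XI; have [w _ wi] := XI _ imag_unit_i; have [v _ vj] := XI _ imag_unit_j.
case: X wi vj {XI} => a b c d [_ _ wc wd] [_ vb _ _].
apply: quat_eq => /=; [ring|rewrite -vb|rewrite -wc|rewrite -wd] => /=; ring.
Qed.

Lemma cplaneP I X : cplane I X <-> exists a b : R, X = a%:A + b *: I.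
Proof.
split=> [[[a b] _ <-]|[a [b ->]]]; first by exists a, b.
by exists (a, b).
Qed.

Lemma cplane_mulI I X : imag_units I -> cplane I X -> cplane I (I * X).
Proof.
move=> /imag_unit_sqr I2 /cplaneP[a [b ->]]; apply/cplaneP; exists (- b), a.
by rewrite mulrDr -!scalerAr mulr1 I2 scalerN scaleNr addrC.
Qed.

Lemma cplaneD I X Y : cplane I X -> cplane I Y -> cplane I (X + Y).
Proof.
move=> /cplaneP[a [b ->]] /cplaneP[c [d ->]]; apply/cplaneP.
by exists (a + c), (b + d); rewrite addrACA -!scalerDl.
Qed.

Lemma cplaneZ I X (k : R) : cplane I X -> cplane I (k *: X).
Proof.
move=> /cplaneP[a [b ->]]; apply/cplaneP; exists (k * a), (k * b).
by rewrite scalerDr !scalerA.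
Qed.

Lemma cplaneN I X : cplane (- I) X -> cplane I X.
Proof.
move=> /cplaneP[a [b ->]]; apply/cplaneP; exists a, (- b).
by rewrite scalerN scaleNr.
Qed.

(** A slice preserving function has real stem functions: their values lie in
    every complex slice. *)
Lemma slice_preserving_real O f z : circular O -> slice_preserving O f ->
  stem_dom O z -> exists a b : R, forall I, imag_units I ->
    f (quat_of z I) = a%:A + b *: I.
Proof.
move=> cO [[F0 [F1 [_ Ff]]] fC] Oz.
have fE I : imag_units I -> f (quat_of z I) = F0 z + I * F1 z.
  by move=> I1; apply: Ff => //; exact: stem_dom_quat_of.
have fI I : imag_units I -> cplane I (F0 z + I * F1 z).
  move=> I1; rewrite -fE//; apply: (fC _ I1); exists (quat_of z I) => //.
  by split; [exact: stem_dom_quat_of|exists z].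
have fNI I : imag_units I -> cplane I (F0 z - I * F1 z).
  by move=> I1; apply: cplaneN; rewrite -mulNr; apply: fI; exact: imag_unitN.
have half (x : H) : x = (2 : R)^-1 *: (x + x).
  by rewrite -{2 3}[x]scale1r -scalerDl scalerA mulVf ?scale1r ?pnatr_eq0.
have F0E : F0 z = (coord0 (F0 z))%:A.
  apply: cplane_common => I I1; rewrite [F0 z]half.
  have -> : F0 z + F0 z = (F0 z + I * F1 z) + (F0 z - I * F1 z).
    by rewrite addrACA subrr addr0.
  by apply/cplaneZ/cplaneD; [exact: fI|exact: fNI].
have F1E : F1 z = (coord0 (F1 z))%:A.
  apply: cplane_common => I I1.
  have -> : F1 z = (-1 : R) *: (I * (I * F1 z)).
    by rewrite mulrA imag_unit_sqr// mulN1r scaleN1r opprK.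
  apply/cplaneZ/cplane_mulI => //; rewrite [I * F1 z]half.
  have -> : I * F1 z + I * F1 z =
      (F0 z + I * F1 z) + (-1 : R) *: (F0 z - I * F1 z).
    by rewrite scaleN1r opprB [F0 z + _]addrC addrACA subrr addr0.
  by apply/cplaneZ/cplaneD; [exact: fI|apply/cplaneZ/fNI].
exists (coord0 (F0 z)), (coord0 (F1 z)) => I I1.
by rewrite fE// {1}F0E {1}F1E -scalerAr mulr1.
Qed.

(** Uniqueness of the real part holds pointwise, by [slice_preserving_real];
    its existence is that of the functions induced by the four coordinates of
    the stem function. *)
Lemma real_part_stem O G0 G1 g I z : circular O -> open O ->
  stem_of O G0 G1 g -> imag_units I -> O (quat_of z I) ->
  real_part O g (quat_of z I) = (coord0 (G0 z))%:A + coord0 (G1 z) *: I.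
Proof.
move=> cO oO [hG Gg] I1 zO; have Oz : stem_dom O z by exists I.
rewrite /real_part; case: xgetP => [f0 _ [f1 [f2 [f3 [f0p f1p f2p f3p gE]]]]|].
  have [a0 [b0 f0E]] := slice_preserving_real cO f0p Oz.
  have [a1 [b1 f1E]] := slice_preserving_real cO f1p Oz.
  have [a2 [b2 f2E]] := slice_preserving_real cO f2p Oz.
  have [a3 [b3 f3E]] := slice_preserving_real cO f3p Oz.
  have [GE0 GE1] : G0 z = Quat a0 a1 a2 a3 /\ G1 z = Quat b0 b1 b2 b3.
    apply: induced_inj => J J1.
    have OJ := stem_dom_quat_of cO J1 Oz.
    rewrite -(Gg _ _ J1 OJ) gE// f0E// f1E// f2E// f3E//.
    by case: J {J1 OJ} => x y u v; apply: quat_eq => /=; ring.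
  by rewrite f0E// GE0 GE1.
pose part n := slice_extension (fun w => (qcoord n (G0 w))%:A)
  (fun w => (qcoord n (G1 w))%:A).
have [_ _ symG _] := hG.
have partE n J w : imag_units J -> stem_dom O w ->
    part n (quat_of w J) = (qcoord n (G0 w))%:A + qcoord n (G1 w) *: J.
  move=> J1 /symG[e0 e1].
  rewrite /part slice_extensionE ?e0 ?e1 ?qcoordN ?scaleNr//.
  by rewrite -scalerAr mulr1.
have partP n : (n < 4)%N -> slice_preserving O (part n).
  move=> n4; split=> [|J J1 _ [q [Oq [w _ wq]] <-]]; last first.
    rewrite -wq partE//; last by exists J => //; rewrite wq.
    by apply/cplaneP; exists (qcoord n (G0 w)), (qcoord n (G1 w)).
  exists (fun w => (qcoord n (G0 w))%:A), (fun w => (qcoord n (G1 w))%:A).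
  have sym w : stem_dom O w ->
      (qcoord n (G0 (conjz w)))%:A = (qcoord n (G0 w))%:A :> H /\
      (qcoord n (G1 (conjz w)))%:A = - (qcoord n (G1 w))%:A :> H.
    by move=> /symG[-> ->]; rewrite qcoordN scaleNr.
  split; last exact: slice_extension_induces.
  apply: holomorphic_stem_of_coord sym; first exact: open_stem_dom.
  move=> m m4; have [->|m0] := eqVneq m 0%N.
    rewrite (_ : stem_coord _ _ _ = stem_coord n G0 G1).
      exact: holomorphic_stem_coord hG.
    by apply/funext => w; rewrite /stem_coord /= !mulr1.
  (* a real stem function has no coordinates along i, j and k *)
  rewrite (_ : stem_coord _ _ _ = fun=> 0); first exact: holomorphic_cst.
  apply/funext => w; rewrite /stem_coord.
  by case: m m0 {m4} => [|[|[|m]]]//= _; rewrite !mulr0.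
move=> /(_ (part 0%N)) []; exists (part 1%N), (part 2%N), (part 3%N).
split; try exact: partP.
move=> q Oq; rewrite -(quat_of_slice q).
have q1 := imag_slice_unit q.
have Ow : stem_dom O (slice_point q).
  by exists (slice_unit q); rewrite ?quat_of_slice.
rewrite !partE// Gg ?quat_of_slice//=.
move: (slice_unit q) (G0 _) (G1 _) => [x y u v] [a b c d] [a' b' c' d'].
by apply: quat_eq => /=; ring.
Qed.

Lemma qconj_induces O G0 G1 g : stem_of O G0 G1 g ->
  induces O (@qconj R \o G0) (@qconj R \o G1)
    (slice_extension (@qconj R \o G0) (@qconj R \o G1)).
Proof.
move=> [[_ _ sym _] _]; apply: slice_extension_induces => z /sym[e0 e1] /=.
rewrite e0 e1; split=> //; case: (G1 z) => a b c d; apply: quat_eq => /=; ring.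
Qed.

(** The equation [g^s = 1] says that the stem function of [g] has norm one in
    the complexified quaternions. *)
Lemma symmetrization_stem O G0 G1 g z : circular O -> stem_of O G0 G1 g ->
  (forall q, O q -> symmetrization O g q = 1) -> stem_dom O z ->
  \sum_(n < 4) stem_coord n G0 G1 z ^+ 2 = 1.
Proof.
move=> cO Gg gs Oz.
have conjE J : imag_units J ->
    slice_conj O g (quat_of z J) = qconj (G0 z) + J * qconj (G1 z).
  move=> J1; rewrite /slice_conj; case: xgetP => [h _ [F0 [F1 [Fg hF]]]|].
    have [e0 e1] := stem_of_unique cO Oz Fg.2 Gg.2.
    by rewrite hF//=; [rewrite e0 e1|exact: stem_dom_quat_of].
  move=> /(_ (slice_extension (@qconj R \o G0) (@qconj R \o G1)))[].
  by exists G0, G1; split => //; exact: qconj_induces Gg.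
have sE I : imag_units I -> (G0 z * qconj (G0 z) - G1 z * qconj (G1 z)) +
    I * (G1 z * qconj (G0 z) + G0 z * qconj (G1 z)) = 1 + I * 0.
  move=> I1; have zI := stem_dom_quat_of cO I1 Oz.
  rewrite mulr0 addr0 -(gs (quat_of z I))// /symmetrization.
  rewrite (star_induced g I1 conjE) (Gg.2 _ _ I1)//.
  rewrite !mulrDl !mulrDr !mulrA (imag_unit_sqr I1) mulN1r mulNr.
  by rewrite addrACA [- _ + _]addrC.
have [] := induced_inj sE.
rewrite !big_ord_recr big_ord0 /= /stem_coord.
case: (G0 z) (G1 z) => [a b c d] [a' b' c' d'] [re0 _ _ _] [im0 _ _ _].
apply: complex_ext; rewrite !(reD,imD,reM,imM,expr2) /=.
  by rewrite -re0; ring.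
by have := im0; lra.
Qed.

End stem_of_slice_functions.

(** * The logarithm *)

Section star_logarithm.
Context {R : realType}.
Local Notation C := R[i].
Local Notation H := (quat R).
Implicit Types (c d : C) (I J p q X Y : H) (z : R * R).

(** [R[i]] acts on the complexified quaternions; at the unit [I] of a sphere
    this is the left multiplication by [c] read in the slice of [I]. *)
Definition slice_scalar I c : H := quat_of (Re c, Im c) I.

Lemma slice_scalarE I c : slice_scalar I c = Re c *: 1 + Im c *: I.
Proof. by []. Qed.

Lemma slice_scalarD I c d :
  slice_scalar I (c + d) = slice_scalar I c + slice_scalar I d.
Proof. by rewrite !slice_scalarE reD imD !scalerDl addrACA. Qed.

Lemma slice_scalarN I c : slice_scalar I (- c) = - slice_scalar I c.
Proof. by rewrite !slice_scalarE reN imN !scaleNr opprD. Qed.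

Lemma slice_scalar1 I : slice_scalar I 1 = 1.
Proof. by rewrite slice_scalarE /= scale1r scale0r addr0. Qed.

Lemma slice_scalar0 I : slice_scalar I 0 = 0.
Proof. by rewrite slice_scalarE /= !scale0r addr0. Qed.

Lemma slice_scalarM I c d : imag_units I ->
  slice_scalar I (c * d) = slice_scalar I c * slice_scalar I d.
Proof.
move=> /imag_unit_sqr I2; rewrite !slice_scalarE reM imM.
rewrite mulrDl !mulrDr -!scalerAl -!scalerAr !mul1r !mulr1 I2 !scalerA.
by rewrite scalerN scalerBl scalerDl addrACA [- _ + _]addrC.
Qed.

Lemma slice_scalar_comm I c : imag_units I ->
  I * slice_scalar I c = slice_scalar I c * I.
Proof.
move=> I1; rewrite !slice_scalarE mulrDl mulrDr -!scalerAl -!scalerAr.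
by rewrite mul1r mulr1.
Qed.

Lemma slice_scalar_induced I c X Y : imag_units I ->
  slice_scalar I c * (X + I * Y) =
  (Re c *: X - Im c *: Y) + I * (Re c *: Y + Im c *: X).
Proof.
move=> /imag_unit_sqr I2.
rewrite slice_scalarE mulrDl !mulrDr -!scalerAl -!scalerAr.
by rewrite !mul1r !mulrA I2 mulN1r scalerN [RHS]addrACA [- _ + _]addrC.
Qed.

Lemma stem_coord_scalar n c X Y :
  qcoord n (Re c *: X - Im c *: Y) +i* qcoord n (Re c *: Y + Im c *: X) =
  c * (qcoord n X +i* qcoord n Y) :> C.
Proof.
by apply: complex_ext; rewrite ?reM ?imM /= !(qcoordD,qcoordN,qcoordZ).
Qed.

(** Vector quaternions square to minus their norm, also after
    complexification. *)
Lemma vector_sqr I (X Y : H) : imag_units I -> coord0 X = 0 -> coord0 Y = 0 ->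
  (X + I * Y) * X + I * ((X + I * Y) * Y) =
  - slice_scalar I (\sum_(n < 4) (qcoord n X +i* qcoord n Y) ^+ 2).
Proof.
move=> I1 X0 Y0.
have -> : (X + I * Y) * X + I * ((X + I * Y) * Y) =
    (X * X - Y * Y) + I * (Y * X + X * Y).
  rewrite !mulrDl !mulrDr !mulrA (imag_unit_sqr I1) mulN1r mulNr.
  by rewrite [in RHS]addrACA [- _ + _]addrC.
rewrite !big_ord_recr big_ord0 /=.
case: X Y X0 Y0 => [a b e f] [a' b' e' f'] /= -> ->.
case: I I1 => x y u v _.
by apply: quat_eq; rewrite !(reD,imD,reM,imM,expr2) /=; ring.
Qed.

(** The powers of a complex multiple of a vector stay in the span of 1 and of
    this vector over the complex numbers. *)
Lemma star_pow_exp_coefs (f : H -> H) z c u X Y I n :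
  coord0 X = 0 -> coord0 Y = 0 ->
  \sum_(n < 4) (qcoord n X +i* qcoord n Y) ^+ 2 = 1 - u ^+ 2 ->
  (forall J, imag_units J ->
     f (quat_of z J) = slice_scalar J c * (X + J * Y)) ->
  imag_units I ->
  star_pow f n (quat_of z I) = slice_scalar I (exp_coefs u c n).1 +
    slice_scalar I (exp_coefs u c n).2 * (X + I * Y).
Proof.
move=> X0 Y0 XY fE; elim: n I => [|n ih] I I1.
  by rewrite /= slice_scalar1 slice_scalar0 mul0r addr0.
pose a := (exp_coefs u c n).1; pose b := (exp_coefs u c n).2.
have ihE J : imag_units J -> star_pow f n (quat_of z J) =
    (Re a *: 1 + (Re b *: X - Im b *: Y)) +
    J * (Im a *: 1 + (Re b *: Y + Im b *: X)).
  move=> J1; rewrite ih// slice_scalar_induced// slice_scalarE -/a -/b.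
  by rewrite [J * ((Im a)%:A + _)]mulrDr -(scalerAr (Im a) J 1) mulr1 addrACA.
rewrite /star_pow iterS -/(star_pow f n) (star_induced f I1 ihE) fE//.
have V2 := vector_sqr I1 X0 Y0; rewrite XY in V2.
set W := X + I * Y in V2 *; set K := slice_scalar I c.
have -> : slice_scalar I (exp_coefs u c n.+1).1 =
    K * slice_scalar I b * (W * X + I * (W * Y)).
  rewrite V2 mulrN /= slice_scalarN -/b !slice_scalarM//; congr (- _).
  by rewrite -!slice_scalarM//; congr slice_scalar; ring.
have -> : slice_scalar I (exp_coefs u c n.+1).2 = K * slice_scalar I a.
  by rewrite /= slice_scalarM.
have KC d : K * slice_scalar I d = slice_scalar I d * K.
  by rewrite -!slice_scalarM// mulrC.
have KI : I * K = K * I by exact: slice_scalar_comm.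
move: W K KC KI {V2} => W K KC KI.
have PX d X' Y' : K * W * (Re d *: X' - Im d *: Y') +
    I * (K * W * (Re d *: Y' + Im d *: X')) =
    slice_scalar I d * (K * W * X' + I * (K * W * Y')).
  by rewrite slice_scalar_induced// mulrBr (mulrDr (K * W)) -!scalerAr.
have := PX a 1 0; rewrite !scaler0 subr0 add0r mulr1 !mulr0 addr0 => Pa.
rewrite (mulrDr (K * W)) (mulrDr (K * W) (Im a *: 1)) (mulrDr I) addrACA Pa PX.
have -> : K * W * X + I * (K * W * Y) = K * (W * X + I * (W * Y)).
  by rewrite mulrDr !mulrA KI.
by rewrite !KC addrC !mulrA.
Qed.

Lemma cvg_slice_scalar (c : nat -> C) l I W :
  ccvg \oo c l ->
  slice_scalar I (c N) * W @[N --> \oo] --> slice_scalar I l * W.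
Proof.
move=> [c1 c2]; rewrite slice_scalarE mulrDl -!scalerAl mul1r.
under eq_fun do rewrite slice_scalarE mulrDl -!scalerAl mul1r.
by apply: cvgD; apply: cvgZ => //; exact: cvg_cst.
Qed.

Lemma slice_scalar_sum I (a : nat -> C) N :
  slice_scalar I (\sum_(n < N) a n / n`!%:R) =
  \sum_(0 <= n < N) (n`!%:R : R)^-1 *: slice_scalar I (a n).
Proof.
rewrite big_mkord; elim: N => [|N ih]; first by rewrite !big_ord0 slice_scalar0.
rewrite !big_ord_recr /= slice_scalarD ih; congr (_ + _).
have -> : a N / N`!%:R = (N`!%:R^-1)%:C * a N.
  by rewrite fmorphV rmorph_nat mulrC.
by rewrite !slice_scalarE scalerDr !scalerA reM imM /= !mul0r subr0 addr0.
Qed.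

(** The exponential series of [c V], where [V] is the vector part and [u] the
    scalar part of an element of norm one of the complexified quaternions. *)
Lemma star_exp_cvg (f : H -> H) z u X Y I :
  coord0 X = 0 -> coord0 Y = 0 ->
  \sum_(n < 4) (qcoord n X +i* qcoord n Y) ^+ 2 = 1 - u ^+ 2 ->
  off_cut u ->
  (forall J, imag_units J ->
     f (quat_of z J) = slice_scalar J (arccos_ratio u) * (X + J * Y)) ->
  imag_units I ->
  [series (n`!%:R : R)^-1 *: star_pow f n (quat_of z I)]_n @ \oo -->
    slice_scalar I u + (X + I * Y).
Proof.
move=> X0 Y0 XY uc fE I1; have [p1 p2] := exp_coefs_cvg uc.
set k := arccos_ratio u in fE p1 p2.
have -> : [series (n`!%:R : R)^-1 *: star_pow f n (quat_of z I)]_n = (fun N =>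
    slice_scalar I (\sum_(n < N) (exp_coefs u k n).1 / n`!%:R) * 1 +
    slice_scalar I (\sum_(n < N) (exp_coefs u k n).2 / n`!%:R) * (X + I * Y)).
  apply/funext => N.
  rewrite (slice_scalar_sum I (fun n => (exp_coefs u k n).1)).
  rewrite (slice_scalar_sum I (fun n => (exp_coefs u k n).2)).
  rewrite mulr1 mulr_suml -big_split/=; apply: eq_bigr => n _.
  by rewrite (star_pow_exp_coefs _ X0 Y0 XY fE I1) scalerDr scalerAl.
rewrite -[slice_scalar I u]mulr1 -[X + I * Y in X in _ --> X]mul1r.
rewrite -(slice_scalar1 I).
by apply: cvgD; exact: cvg_slice_scalar.
Qed.

End star_logarithm.

Theorem theorem1p5 (R : realType) (Omega : set (quat R)) (g : quat R -> quat R)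
  (hdom : domain Omega)
  (hcirc : circular Omega)
  (hcontr : slice_contractible Omega)
  (hg : slice_regular Omega g)
  (hgs : forall q, Omega q -> symmetrization Omega g q = 1)
  (hzero : forall q0, nonreal_isolated_zero Omega (vector_part Omega g) q0 ->
     real_part Omega g q0 = 1)
  (U : set (quat R))
  (hU : let A := Omega `\` (real_part Omega g @^-1` @real_le_m1 R) in
     (connected_component A @` A) U) :
  exists f : quat R -> quat R,
    slice_regular U f /\ is_star_exponential U f g.
Proof.
have [_ _ oO] := hdom; have [G0 [G1 Gg]] := hg; have [hG gE] := Gg.
have [_ _ symG _] := hG.
pose D := stem_dom Omega; pose u := stem_coord 0 G0 G1.
have oD : open D by exact: open_stem_dom.
pose E := D `&` [set z | off_cut (u z)].
have uD : holomorphic D u by exact: holomorphic_stem_coord hG.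
have oE : open E by exact: open_off_cut.
have DE : E `<=` D by move=> z [].
pose k z := arccos_ratio (u z).
have kE : holomorphic E k.
  apply: holomorphic_arccos_ratio => //; first exact: holomorphic_sub uD.
  by move=> z [].
have UE : stem_dom U `<=` E.
  move: hU => [x _ <-] z [I I1 /connected_component_sub[zO zcut]].
  split; first by exists I.
  move=> [u0 u1]; apply: zcut; rewrite /= (real_part_stem hcirc oO Gg I1 zO).
  exists (coord0 (G0 z)) => //; move: u0; rewrite /u /= => ->.
  by rewrite scale0r addr0.
(* the components of [k] times the vector part of the stem function *)
pose F0 z := Re (k z) *: qvec (G0 z) - Im (k z) *: qvec (G1 z).
pose F1 z := Re (k z) *: qvec (G1 z) + Im (k z) *: qvec (G0 z).
have vecE n z : (n < 4)%N -> qcoord n (qvec (G0 z)) +i* qcoord n (qvec (G1 z)) =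
    if n == 0%N then 0 else stem_coord n G0 G1 z.
  case: n => [|[|[|[|n]]]]//= _; rewrite /stem_coord /=;
    apply: complex_ext => /=;
    by rewrite ?mulr1 ?mulr0 ?subrr ?subr0.
have symE z : E z -> F0 (conjz z) = F0 z /\ F1 (conjz z) = - F1 z.
  move=> [/symG[e0 e1] zc].
  have kc : k (conjz z) = (k z)^*.
    rewrite /k /u stem_coord_conjz// arccos_ratio_conj//.
    exact: off_cut_pole_free.
  have vN : qvec (- G1 z) = - qvec (G1 z).
    by case: (G1 z) => a b c d; apply: quat_eq => /=; ring.
  rewrite /F0 /F1 kc e0 e1 vN; case: (k z) => a b /=.
  by rewrite !scaleNr !scalerN !opprK opprD; split.
have hF : holomorphic_stem E F0 F1.
  apply: holomorphic_stem_of_coord => // n n4.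
  have -> : stem_coord n F0 F1 = fun z => k z *
      (if n == 0%N then 0 else stem_coord n G0 G1 z).
    by apply/funext => z; rewrite -vecE// -stem_coord_scalar.
  apply: holomorphicM => //; case: (n == 0%N); first exact: holomorphic_cst.
  by apply: holomorphic_sub DE _; exact: holomorphic_stem_coord hG.
exists (slice_extension F0 F1); split.
  exists F0, F1; split; first exact: holomorphic_stem_sub UE hF.
  by apply: slice_extension_induces => z /UE; exact: symE.
move=> q Uq; rewrite -(quat_of_slice q).
set z := slice_point q; set I := slice_unit q.
have I1 : imag_units I by exact: imag_slice_unit.
have Ez : E z by apply: UE; exists I; rewrite ?quat_of_slice.
have [Dz uc] := Ez; have [e0 e1] := symE _ Ez.
have gz : g (quat_of z I) =
    slice_scalar I (u z) + (qvec (G0 z) + I * qvec (G1 z)).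
  rewrite gE//; last exact: stem_dom_quat_of.
  rewrite /slice_scalar /quat_of /u /= /qvec mulrBr -scalerAr mulr1.
  by rewrite addrACA [_%:A + _]addrC subrK [_ *: I + _]addrC subrK.
rewrite gz; apply: star_exp_cvg => //.
- by rewrite /qvec /= mulr1 subrr.
- by rewrite /qvec /= mulr1 subrr.
- rewrite (eq_bigr (fun n : 'I_4 => (if n == 0%N :> nat then 0
      else stem_coord n G0 G1 z) ^+ 2)) => [|n _]; last by rewrite vecE.
  have := symmetrization_stem hcirc Gg hgs Dz.
  rewrite !big_ord_recl => <-.
  by rewrite /= expr0n /= add0r [X in X - _]addrC addrK.
- move=> J J1; rewrite slice_extensionE// slice_scalar_induced//.
Qed.
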